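(* Let $X$ be a weakly non-null stationary ergodic process with finite alphabet $A$ whose continuity rates satisfy $\bar\gamma(k)\le\delta_12^{-\zeta_1k}$ and $\underline\gamma(k)\ge\delta_22^{-\zeta_2k}$ for all $k$, for some $\zeta_1,\zeta_2,\delta_1,\delta_2>0$ with $\zeta_2\ge\zeta_1$. Let IC be either the PML criterion with penalty function $\mathrm{pen}(n)=O(\sqrt n)$, or the NML criterion, or the KT criterion. If $\frac{6\log|A|}{\zeta_1}\le\varepsilon<\frac12$, then \[ \Pr\Bigl(\hat k_{\mathrm{IC}}(X_1^n)\le\frac{1}{2\zeta_2}\Bigl(\frac12-\varepsilon\Bigr)\log n-c_3\Bigr)\le\exp\Bigl(-\frac{c_2\varepsilon^3}{\log n}n^{\varepsilon/2}\Bigr) \] for all $n\ge n_0$, where $c_2,n_0>0$ and $c_3\in\mathbb R$ are constants depending only on the distribution of the process and on $\mathrm{pen}(n)$.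
   Context: $A$ finite alphabet, $|A|\ge2$; $X=\{X_i\}_{i\in\mathbb Z}$ stationary ergodic with values in $A$; $P(a|x_{-k}^{-1})=\Pr(X_0=a\mid X_{-k}^{-1}=x_{-k}^{-1})$, $P(a|x_{-\infty}^{-1})$ the conditional probability given the infinite past; logs base 2. Weakly non-null: $\sum_{a}\inf_{x_{-\infty}^{-1}}P(a|x_{-\infty}^{-1})>0$. Continuity rates: $\bar\gamma(k)=\sup_{x_{-\infty}^{-1}\in A^\infty}\sum_{a\in A}|P(a|x_{-k}^{-1})-P(a|x_{-\infty}^{-1})|$ and $\underline\gamma(k)=\inf_{x_{-\infty}^{-1}\in A^\infty}\sum_{a\in A}|P(a|x_{-k}^{-1})-P(a|x_{-\infty}^{-1})|$. Counts $N_n(a_1^k)=|\{i:0\le i\le n-k,\ X_{i+1}^{i+k}=a_1^k\}|$, $\hat P(a_{k+1}|a_1^k)=N_n(a_1^{k+1})/N_{n-1}(a_1^k)$. $\mathrm{ML}_k(X_1^n)=\prod_{a_1^{k+1}}\hat P(a_{k+1}|a_1^k)^{N_n(a_1^{k+1})}$. $\mathrm{pen}(n)$ is a non-decreasing function. For $0\le k<n$: $\mathrm{PML}_{X_1^n}(k)=-\log\mathrm{ML}_k(X_1^n)+(|A|-1)|A|^k\mathrm{pen}(n)$; $\mathrm{NML}_{X_1^n}(k)=-\log\mathrm{ML}_k(X_1^n)+\log\sum_{x_1^n\in A^n}\mathrm{ML}_k(x_1^n)$; $\mathrm{KT}_{X_1^n}(k)=-\log P_{\mathrm{KT},k}(X_1^n)$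 with $P_{\mathrm{KT},k}(X_1^n)=|A|^{-k}\prod_{a_1^k:N_{n-1}(a_1^k)\ge1}\frac{\prod_{a_{k+1}:N_n(a_1^{k+1})\ge1}(N_n(a_1^{k+1})-\frac12)\cdots\frac12}{(N_{n-1}(a_1^k)-1+\frac{|A|}2)\cdots\frac{|A|}2}$ (for $k=0$, $N_{n-1}(a_1^k)=n$). $\hat k_{\mathrm{IC}}(X_1^n)=\arg\min_{0\le k<n}\mathrm{IC}_{X_1^n}(k)$ (smallest minimizer). *)

(* Defs.v *)
From HB Require Import structures.
From mathcomp Require Import all_boot all_order all_algebra.
From mathcomp Require Import all_classical all_reals all_analysis.

Set Implicit Arguments.
Unset Strict Implicit.
Unset Printing Implicit Defensive.

Import Order.TTheory GRing.Theory Num.Theory numFieldNormedType.Exports.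
Local Open Scope classical_set_scope.
Local Open Scope ring_scope.

Definition log2 {R : realType} (x : R) : R := ln x / ln 2.

Section Paths.
Variable A : Type.

Definition coord_sets : set (set (int -> A)) :=
  [set E | exists (i : int) (a : A), E = [set x | x i = a]].

Definition shift (x : int -> A) : int -> A := fun i => x (i + 1).

Definition block (x : int -> A) (s : int) (k : nat) : seq A :=
  [seq x (s + (j%:Z)) | j <- iota 0 k].

(* x_{-k}^{-1} (only the coordinates with negative index of x are used) *)
Definition past_word (x : int -> A) (k : nat) : seq A := block x (- (k%:Z)) k.
End Paths.
Arguments shift {A} x i.
Arguments block {A} x s k.
Arguments past_word {A} x k.

Section Process.
Variables (R : realType) (d : measure_display) (Omega : measurableType d).
Variable (P : probability Omega R).
Variables (A : finType) (X : int -> Omega -> A).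

Definition path_of (w : Omega) : int -> A := fun i => X i w.

(* each X_i is a random variable (A carries the discrete sigma-algebra) *)
Definition is_process : Prop :=
  forall (i : int) (a : A), measurable [set w | X i w = a].

Definition stationary : Prop :=
  forall B : set (int -> A), <<s @coord_sets A >> B ->
    P (path_of @^-1` (shift @^-1` B)) = P (path_of @^-1` B).

Definition ergodic : Prop :=
  forall B : set (int -> A), <<s @coord_sets A >> B ->
    shift @^-1` B = B ->
    P (path_of @^-1` B) = 0%E \/ P (path_of @^-1` B) = 1%E.

Definition block_prob (s : int) (u : seq A) : R :=
  fine (P [set w | block (path_of w) s (size u) = u]).

Definition condP (x : int -> A) (k : nat) (a : A) : R :=
  block_prob (- (k%:Z)) (rcons (past_word x k) a) /
  block_prob (- (k%:Z)) (past_word x k).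

Definition admissible_past (x : int -> A) : Prop :=
  forall k : nat, 0 < block_prob (- (k%:Z)) (past_word x k).

Definition condP_inf (x : int -> A) (a : A) : R := limn (condP x ^~ a).

Definition weakly_non_null : Prop :=
  0 < \sum_(a : A) inf [set condP_inf x a | x in admissible_past].

Definition cont_dev (x : int -> A) (k : nat) : R :=
  \sum_(a : A) `|condP x k a - condP_inf x a|.

Definition gamma_bar (k : nat) : R := sup [set cont_dev x k | x in admissible_past].
Definition gamma_low (k : nat) : R := inf [set cont_dev x k | x in admissible_past].

Definition sample (w : Omega) (n : nat) : seq A := block (path_of w) 1 n.
End Process.

Section Criteria.
Variables (R : realType) (A : finType).

Definition occ (u s : seq A) : nat :=
  \sum_(i < (size s).+1 | (i + size u <= size s)%N) (take (size u) (drop i s) == u).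

Definition Nn (s u : seq A) : nat := occ u s.
Definition Nn1 (s u : seq A) : nat := occ u (take (size s).-1 s).

Definition ML (k : nat) (s : seq A) : R :=
  \prod_(t : (k.+1).-tuple A)
     ((Nn s t)%:R / (Nn1 s (take k t))%:R) ^+ (Nn s t).

Definition PML_crit (pen : nat -> R) (k : nat) (s : seq A) : R :=
  - log2 (ML k s) + ((#|A| - 1) * #|A| ^ k)%:R * pen (size s).

Definition NML_crit (k : nat) (s : seq A) : R :=
  - log2 (ML k s) + log2 (\sum_(y : (size s).-tuple A) ML k y).

Definition P_KT (k : nat) (s : seq A) : R :=
  (#|A|%:R ^- k) *
  \prod_(w : k.-tuple A | (1 <= Nn1 s w)%N)
    ((\prod_(a : A | (1 <= Nn s (rcons w a))%N)
        \prod_(j < Nn s (rcons w a)) (j%:R + 2^-1)) /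
     (\prod_(j < Nn1 s w) (j%:R + #|A|%:R / 2))).

Definition KT_crit (k : nat) (s : seq A) : R := - log2 (P_KT k s).

Inductive criterion := PML of (nat -> R) | NML | KT.

Definition IC_value (c : criterion) : nat -> seq A -> R :=
  match c with
  | PML pen => PML_crit pen
  | NML => NML_crit
  | KT => KT_crit
  end.

Definition khat (c : criterion) (s : seq A) : nat :=
  let n := size s in
  find (fun k => all (fun j => IC_value c k s <= IC_value c j s) (iota 0 n))
       (iota 0 n).

Definition criterion_ok (c : criterion) : Prop :=
  match c with
  | PML pen => {homo pen : m n / (m <= n)%N >-> m <= n} /\
      exists C : R, exists N : nat, forall n : nat, (N <= n)%N ->
        `|pen n| <= C * Num.sqrt (n%:R)
  | _ => True
  end.
End Criteria.

(* Main.v *)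
(* Let [a = 6 log |A| / zeta1] and [k0 = (3 / (2 zeta1)) log n], so that
   [|A|^k0 <= n^(a/4)] while the continuity rate at [k0] is [O(n^(-3/2))].  If the
   criterion prefers some small [k] to [k0], then [ML_k >= exp(- Delta) ML_k0] with
   [Delta = O(|A|^k0 sqrt n)].  Now [ML_k0] is at least the likelihood of a smoothed
   [k0]-step Markov approximation of the process, which by a chi-square bound is
   comparable to the true likelihood, up to an event of probability
   [exp(- sqrt n)].  On the other side, [ML_k] is the likelihood of one of
   [(n+1)^(|A|^(k+1))] Markov kernels [q].  For each of them the expectation of
   [sqrt (q / P)] is a product over blocks of length [O(log^2 n)] of conditional
   Hellinger affinities.  A block affinity is at most [1 - c g^2], with
   [g = delta2 2^(- zeta2 k)]: by exponential mixing (couple two pasts; weak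
   non-nullness and the continuity rates give a uniformly positive probability of
   never separating) the last letter of the block sees an almost stationary past,
   and [q] ignores everything but [k] letters, whereas by the lower rate no past
   predicts like its last [k] letters within less than [g].  Hence the true
   likelihood exceeds that of [q] by a factor [exp(n^(1/2 + a) / polylog n)], which
   beats both [Delta] and the union bound. *)
Require Import Defs.
From HB Require Import structures.
From mathcomp Require Import all_boot all_order all_algebra.
From mathcomp Require Import all_classical all_reals all_analysis.
From mathcomp Require Import ring lra.
Set Implicit Arguments.
Unset Strict Implicit.
Unset Printing Implicit Defensive.
Import Order.TTheory GRing.Theory Num.Theory numFieldNormedType.Exports.
Local Open Scope classical_set_scope.
Local Open Scope ring_scope.

(** * Words and Markov kernels *)

(** Weak non-nullness lets conditional probabilities vanish, and the competing kernels [q], built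
    from counts, vanish often. Relative entropy could then be infinite, so each side uses a quantity
    that stays finite: affinities against [q], which need no lower bound, and a chi-square distance
    to an approximation mixed with the uniform law. The exponents fit as follows. The threshold on k
    is the point where g^2 is still of order n^(a - 1/2), so about n / polylog blocks yield an
    exponent 1/2 + a up to logarithms. The losses (the gap between criterion and likelihood, and the
    logarithm of the number of kernels) are of order |A|^k0 sqrt n, hence at most n^(1/2 + a/4). The
    factor 6 in a is 4 times the 3/2 in k0; with that 3/2, n times the continuity rate at k0 tends
    to 0, and the chi-square loss over n letters stays bounded. The argument runs on a law [p] of
    finite words. Infinite pasts enter only where the hypotheses on the continuity rates and on
    non-nullness are translated: a word of positive probability is extended to an admissible past,
    at the cost of a geometric error. *)

Section Words.
Variables (A : finType) (T : Type) (idx : T) (op : Monoid.com_law idx).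

Lemma big_tuple_nil (F : seq A -> T) : \big[op/idx]_(v : 0.-tuple A) F v = F [::].
Proof.
rewrite (big_pred1 [tuple]) // => v.
by rewrite /= (tuple0 v); apply/esym/eqP/val_inj.
Qed.

Lemma big_tuple_cons (m : nat) (F : seq A -> T) :
  \big[op/idx]_(v : m.+1.-tuple A) F v =
  \big[op/idx]_(a : A) \big[op/idx]_(v : m.-tuple A) F (a :: v).
Proof.
rewrite pair_big /=.
rewrite (reindex (fun p : A * m.-tuple A => [tuple of p.1 :: p.2])) /=.
  by apply: eq_bigr => -[a v] _.
exists (fun v : m.+1.-tuple A => (thead v, [tuple of behead v])) => [[a v] _|v _] /=.
  by congr pair; apply: val_inj.
by rewrite -tuple_eta.
Qed.

Lemma big_tuple_cat (m n : nat) (F : seq A -> T) :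
  \big[op/idx]_(v : (m + n).-tuple A) F v =
  \big[op/idx]_(u : m.-tuple A) \big[op/idx]_(v : n.-tuple A) F (u ++ v).
Proof.
elim: m F => [|m IH] F.
  by rewrite (big_tuple_nil (fun u : seq A => \big[op/idx]_(v : n.-tuple A) F (u ++ v))).
rewrite big_tuple_cons
  (big_tuple_cons _ (fun u : seq A => \big[op/idx]_(v : n.-tuple A) F (u ++ v))).
by apply: eq_bigr => a _; rewrite (IH (fun v => F (a :: v))).
Qed.

Lemma big_tuple_rcons (m : nat) (F : seq A -> T) :
  \big[op/idx]_(v : m.+1.-tuple A) F v =
  \big[op/idx]_(v : m.-tuple A) \big[op/idx]_(a : A) F (rcons v a).
Proof.
elim: m F => [|m IH] F.
  rewrite big_tuple_cons (big_tuple_nil (fun v => \big[op/idx]_(a : A) F (rcons v a))).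
  by apply: eq_bigr => a _; rewrite (big_tuple_nil (fun v => F (a :: v))).
rewrite big_tuple_cons
  (big_tuple_cons m (fun v => \big[op/idx]_(a : A) F (rcons v a))).
by apply: eq_bigr => a _; rewrite (IH (fun v => F (a :: v))).
Qed.

Lemma big_tuple_split (k n : nat) (F : seq A -> T) : (k <= n)%N ->
  \big[op/idx]_(v : n.-tuple A) F v =
  \big[op/idx]_(u : k.-tuple A) \big[op/idx]_(v : (n - k).-tuple A) F (u ++ v).
Proof. by move=> kn; rewrite -big_tuple_cat subnKC. Qed.

End Words.

Section Lastn.
Variable A : eqType.
Implicit Types u w x : seq A.

Definition lastn (k : nat) u := drop (size u - k) u.

Lemma lastn_cat k x w : (k <= size w)%N -> lastn k (x ++ w) = lastn k w.
Proof.
by move=> kw; rewrite /lastn size_cat -addnBA // drop_cat ltnNge leq_addr /= addKn.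
Qed.

Lemma size_lastn k u : (k <= size u)%N -> size (lastn k u) = k.
Proof. by move=> ku; rewrite size_drop subKn. Qed.

Lemma lastn_id u : lastn (size u) u = u.
Proof. by rewrite /lastn subnn drop0. Qed.

Lemma lastnK k u : take (size u - k) u ++ lastn k u = u.
Proof. exact: cat_take_drop. Qed.

End Lastn.

Section Kernels.
Variables (R : realType) (A : finType).
Implicit Types (r q : seq A -> A -> R) (f g : seq A -> R) (u v w x : seq A).

(** The transition operator of [r] on functions of the history. No normalisation is built in, so
    that it also serves for the square-root and chi-square kernels, whose iterates on the constant 1
    are affinities and second moments. *)
Definition step r f u : R := \sum_a r u a * f (rcons u a).

Fixpoint lik r u v : R :=
  if v is a :: v' then r u a * lik r (rcons u a) v' else 1.

Lemma lik_rcons r u v a : lik r u (rcons v a) = lik r u v * r (u ++ v) a.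
Proof.
elim: v u => [|b v IH] u /=; first by rewrite cats0 mulr1 mul1r.
by rewrite IH mulrA cat_rcons.
Qed.

Lemma lik_cat r u v w : lik r u (v ++ w) = lik r u v * lik r (u ++ v) w.
Proof.
elim: v u => [|b v IH] u /=; first by rewrite cats0 mul1r.
by rewrite IH mulrA cat_rcons.
Qed.

Lemma lik_ge0 r u v : (forall u a, 0 <= r u a) -> 0 <= lik r u v.
Proof. by move=> r0; elim: v u => //= a v IH u; apply: mulr_ge0. Qed.

Lemma lik_gt0 r u v : (forall u a, 0 < r u a) -> 0 < lik r u v.
Proof. by move=> r0; elim: v u => //= a v IH u; apply: mulr_gt0. Qed.

Lemma lik_le1 r u v : (forall u a, 0 <= r u a <= 1) -> lik r u v <= 1.
Proof.
move=> r0; elim: v u => //= a v IH u.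
have /andP[ra0 ra1] := r0 u a.
by rewrite mulr_ile1 // lik_ge0 // => u' b; have /andP[] := r0 u' b.
Qed.

(** This is why affinities can be cut into blocks: the affinity of two path laws is an iterate of
    one pointwise kernel. *)
Lemma lik_sqrt r q u v : (forall u a, 0 <= r u a) -> (forall u a, 0 <= q u a) ->
  lik (fun u a => Num.sqrt (r u a * q u a)) u v = Num.sqrt (lik r u v * lik q u v).
Proof.
move=> r0 q0; elim: v u => [|a v IH] u /=; first by rewrite mulr1 sqrtr1.
by rewrite IH -sqrtrM ?mulr_ge0 // mulrACA.
Qed.

Lemma lik_div r q u v :
  lik (fun u a => r u a ^+ 2 / q u a) u v = lik r u v ^+ 2 / lik q u v.
Proof.
elim: v u => [|a v IH] u /=; first by rewrite expr1n invr1 mulr1.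
by rewrite IH exprMn invfM mulrACA.
Qed.

Lemma iter_step m r f u :
  iter m (step r) f u = \sum_(v : m.-tuple A) lik r u v * f (u ++ v).
Proof.
elim: m u => [|m IH] u.
  by rewrite (big_tuple_nil _ (fun v => lik r u v * f (u ++ v))) /= mul1r cats0.
rewrite iterS /step (big_tuple_cons _ _ (fun v => lik r u v * f (u ++ v))).
apply: eq_bigr => a _; rewrite IH big_distrr /=.
by apply: eq_bigr => v _; rewrite mulrA cat_rcons.
Qed.

Lemma step_le r f g u : (forall u a, 0 <= r u a) -> (forall a, f (rcons u a) <= g (rcons u a)) ->
  step r f u <= step r g u.
Proof. by move=> r0 fg; apply: ler_sum => a _; apply: ler_wpM2l. Qed.

Lemma iter_step_le m r f g u : (forall u a, 0 <= r u a) ->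
  (forall v, (size u <= size v)%N -> f v <= g v) -> iter m (step r) f u <= iter m (step r) g u.
Proof.
move=> r0; elim: m u => [|m IH] u fg /=; first exact: fg.
apply: step_le => // a; apply: IH => v; rewrite size_rcons => uv.
by apply: fg; apply: ltnW.
Qed.

Lemma iter_step_ge0 m r f u : (forall u a, 0 <= r u a) -> (forall v, 0 <= f v) ->
  0 <= iter m (step r) f u.
Proof.
move=> r0 f0; elim: m u => [|m IH] u //=.
by apply: sumr_ge0 => a _; apply: mulr_ge0.
Qed.

Lemma stepZ r f (c : R) u : step r (fun v => c * f v) u = c * step r f u.
Proof. by rewrite /step mulr_sumr; apply: eq_bigr => a _; rewrite mulrCA. Qed.

Lemma iter_stepZ m r f (c : R) u :
  iter m (step r) (fun v => c * f v) u = c * iter m (step r) f u.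
Proof.
elim: m u => //= m IH u; rewrite -stepZ.
by apply: eq_bigr => a _; rewrite IH.
Qed.

(** Histories only grow, so a bound uniform over histories of length at least [k] applies afresh in
    each block. *)
Lemma iter_step_block r (k T M : nat) (b : R) u : (forall u a, 0 <= r u a) -> 0 <= b ->
  (forall v, (k <= size v)%N -> iter T (step r) (fun=> 1) v <= b) ->
  (k <= size u)%N -> iter (M * T) (step r) (fun=> 1) u <= b ^+ M.
Proof.
move=> r0 b0 hb ku; elim: M => [|M IH]; first by rewrite mul0n expr0.
rewrite mulSn addnC iterD exprS.
have h : iter (M * T) (step r) (iter T (step r) (fun=> 1)) u <=
         iter (M * T) (step r) (fun v => b * 1) u.
  by apply: iter_step_le => // v uv; rewrite mulr1 hb // (leq_trans ku).
apply: (le_trans h); rewrite iter_stepZ.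
exact: ler_wpM2l.
Qed.

Lemma iter_step_le1 m r u : (forall u a, 0 <= r u a) -> (forall u, \sum_a r u a <= 1) ->
  iter m (step r) (fun=> 1) u <= 1.
Proof.
move=> r0 r1; elim: m u => //= m IH u; apply: le_trans (r1 u).
by apply: ler_sum => a _; rewrite -[leRHS]mulr1; apply: ler_wpM2l.
Qed.

Lemma sum_lik_le1 m r u : (forall u a, 0 <= r u a) -> (forall u, \sum_a r u a <= 1) ->
  \sum_(v : m.-tuple A) lik r u v <= 1.
Proof.
move=> r0 r1; have := iter_step_le1 m u r0 r1; rewrite iter_step.
by under eq_bigr do rewrite mulr1.
Qed.

(** Both weights have mass [mu], so [w i * w' j / mu] couples them; multiplying through by [mu]
    avoids the division and leaves [mu = 0] as a separate case. *)
Lemma weighted_sum_close (I J : finType) (w : I -> R) (w' : J -> R) (F : I -> R) (G : J -> R)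
    (mu D : R) :
  (forall i, 0 <= w i) -> (forall j, 0 <= w' j) ->
  \sum_i w i = mu -> \sum_j w' j = mu ->
  (forall i j, 0 < w i -> 0 < w' j -> `|F i - G j| <= D) ->
  `|\sum_i w i * F i - \sum_j w' j * G j| <= mu * D.
Proof.
move=> w0 w'0 sw sw' FG.
have mu0 : 0 <= mu by rewrite -sw; apply: sumr_ge0.
have [mu_eq0|mu_neq0] := eqVneq mu 0.
  rewrite mu_eq0 mul0r !big1 ?subrr ?normr0 // => i _.
    move: sw'; rewrite mu_eq0 => /eqP; rewrite psumr_eq0 // => /allP/(_ i).
    by rewrite mem_index_enum => /(_ isT)/eqP->; rewrite mul0r.
  move: sw; rewrite mu_eq0 => /eqP; rewrite psumr_eq0 // => /allP/(_ i).
  by rewrite mem_index_enum => /(_ isT)/eqP->; rewrite mul0r.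
have mu_gt0 : 0 < mu by rewrite lt_def mu_neq0.
rewrite -(ler_pM2l mu_gt0) -[X in X * `|_|](ger0_norm mu0) -normrM.
have -> : mu * (\sum_i w i * F i - \sum_j w' j * G j) =
    \sum_i \sum_j w i * w' j * (F i - G j).
  under [RHS]eq_bigr do under eq_bigr do rewrite mulrBr.
  under [RHS]eq_bigr do rewrite sumrB.
  rewrite sumrB mulrBr; congr (_ - _).
    rewrite mulr_sumr; apply: eq_bigr => i _.
    by rewrite -sw' mulr_suml; apply: eq_bigr => j _; ring.
  rewrite exchange_big mulr_sumr /=; apply: eq_bigr => j _.
  by rewrite -sw mulr_suml; apply: eq_bigr => i _; ring.
have -> : mu * (mu * D) = \sum_i \sum_j w i * w' j * D.
  rewrite -{1}sw mulr_suml; apply: eq_bigr => i _.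
  by rewrite -{1}sw' mulr_suml mulr_sumr; apply: eq_bigr => j _; rewrite mulrA.
apply: le_trans (ler_norm_sum _ _ _) _; apply: ler_sum => i _.
apply: le_trans (ler_norm_sum _ _ _) _; apply: ler_sum => j _.
rewrite normrM ger0_norm ?mulr_ge0 //.
have := w0 i; rewrite le_eqVlt => /predU1P[<-|wi]; first by rewrite !mul0r.
have := w'0 j; rewrite le_eqVlt => /predU1P[<-|wj]; first by rewrite mulr0 !mul0r.
by apply: ler_wpM2l; [rewrite mulr_ge0|apply: FG].
Qed.

(** With X and Y the square roots, |C - Q| = |X - Y| (X + Y); balance the two factors by [lam] and
    use (X + Y)^2 <= 2 (C + Q). The bound can be summed term by term over words, with [lam] chosen
    afterwards. *)
Lemma dist_le_affinity (C Q lam : R) : 0 <= C -> 0 <= Q -> 0 < lam ->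
  `|C - Q| <= lam * 2^-1 * (C + Q - 2 * Num.sqrt (C * Q)) + lam^-1 * (C + Q).
Proof.
move=> C0 Q0 lam0; rewrite -(sqr_sqrtr C0) -(sqr_sqrtr Q0).
move: (sqrtr_ge0 C) (sqrtr_ge0 Q); move: (Num.sqrt C) (Num.sqrt Q) => X Y X0 Y0.
rewrite -exprMn sqrtr_sqr [`|X * Y|]ger0_norm ?mulr_ge0 // subr_sqr normrM.
rewrite [`|X + Y|]ger0_norm ?addr_ge0 // -subr_ge0.
have [d [d2 ->]] : exists d, d ^+ 2 = (X - Y) ^+ 2 /\ `|X - Y| = d.
  by exists `|X - Y|; rewrite real_normK ?num_real.
have -> : lam * 2^-1 * (X ^+ 2 + Y ^+ 2 - 2 * (X * Y)) + lam^-1 * (X ^+ 2 + Y ^+ 2)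
      - d * (X + Y) =
   2^-1 * lam^-1 * ((lam * d - (X + Y)) ^+ 2 + d ^+ 2) +
   (lam * 2^-1 + 2^-1 * lam^-1) * ((X - Y) ^+ 2 - d ^+ 2).
  by field; rewrite gt_eqF.
rewrite d2 subrr mulr0 addr0 mulr_ge0 ?addr_ge0 ?sqr_ge0 //.
by rewrite mulr_ge0 // invr_ge0 ltW.
Qed.

End Kernels.

(** * Mixing of stationary processes with geometric continuity rates *)

Section Process.
Variables (R : realType) (A : finType).
Implicit Types (u v w x y : seq A) (f : seq A -> R).

(** At a null history the division returns 0, so there the kernel is zero instead of stochastic. *)
Definition cond (p : seq A -> R) u (a : A) : R := p (rcons u a) / p u.

(** A stationary process through its finite-dimensional marginals: the third clause is consistency,
    the fourth shift invariance. *)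
Definition stationary_law (p : seq A -> R) : Prop :=
  [/\ forall u, 0 <= p u, p [::] = 1,
      forall u, \sum_a p (rcons u a) = p u &
      forall u, \sum_a p (a :: u) = p u].

Variable p : seq A -> R.
Hypothesis plaw : stationary_law p.

Let p_ge0 u : 0 <= p u. Proof. by case: plaw. Qed.
Let p_nil : p [::] = 1. Proof. by case: plaw. Qed.
Let p_rcons u : \sum_a p (rcons u a) = p u. Proof. by case: plaw. Qed.
Let p_cons u : \sum_a p (a :: u) = p u. Proof. by case: plaw. Qed.

Let c := cond p.

Lemma law_rcons_le u a : p (rcons u a) <= p u.
Proof. by rewrite -(p_rcons u) (bigD1 a) //= lerDl sumr_ge0. Qed.

Lemma law_cons_le u a : p (a :: u) <= p u.
Proof. by rewrite -(p_cons u) (bigD1 a) //= lerDl sumr_ge0. Qed.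

Lemma law_suffix_le x w : p (x ++ w) <= p w.
Proof. by elim: x => //= a x IH; apply: le_trans (law_cons_le _ _) IH. Qed.

Lemma law_suffix_gt0 x w : 0 < p (x ++ w) -> 0 < p w.
Proof. by move=> h; apply: lt_le_trans h (law_suffix_le _ _). Qed.

Lemma sum_law_cat m w : \sum_(x : m.-tuple A) p (x ++ w) = p w.
Proof.
elim: m w => [|m IH] w; first by rewrite (big_tuple_nil _ (fun x => p (x ++ w))).
rewrite (big_tuple_cons _ _ (fun x => p (x ++ w))) exchange_big /=.
by under eq_bigr do rewrite p_cons; apply: IH.
Qed.

Lemma sum_law m : \sum_(x : m.-tuple A) p x = 1.
Proof.
by rewrite -p_nil -(sum_law_cat m [::]); apply: eq_bigr => x _; rewrite cats0.
Qed.

Lemma cond_ge0 u a : 0 <= c u a. Proof. exact: divr_ge0. Qed.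

Lemma law_condE u a : p (rcons u a) = p u * c u a.
Proof.
rewrite /c /cond; have [pu0|pu] := eqVneq (p u) 0; last by rewrite mulrC divfK.
rewrite pu0 mul0r; apply/le_anti; rewrite p_ge0 andbT.
by rewrite -pu0 law_rcons_le.
Qed.

Lemma sum_cond u : 0 < p u -> \sum_a c u a = 1.
Proof. by move=> pu; rewrite -mulr_suml p_rcons divff // gt_eqF. Qed.

Lemma sum_cond_le1 u : \sum_a c u a <= 1.
Proof.
have := p_ge0 u; rewrite le_eqVlt => /predU1P[pu0|/sum_cond->//].
by rewrite /c /cond -pu0 invr0 big1 // => a _; rewrite mulr0.
Qed.

Lemma cond_gt0 u a : 0 < c u a -> 0 < p (rcons u a).
Proof.
rewrite /c /cond => h; rewrite lt_def p_ge0 andbT.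
by apply: contraTneq h => ->; rewrite mul0r ltxx.
Qed.

Lemma law_lik u v : p (u ++ v) = p u * lik c u v.
Proof.
elim/last_ind: v => [|v a IH]; first by rewrite cats0 mulr1.
by rewrite -rcons_cat law_condE IH lik_rcons mulrA.
Qed.

Lemma law_likE v : p v = lik c [::] v.
Proof. by have := law_lik [::] v; rewrite p_nil mul1r. Qed.

Lemma cond_eq0 u a : p u = 0 -> c u a = 0.
Proof. by rewrite /c /cond => ->; rewrite invr0 mulr0. Qed.

Lemma sum_lik_cond m u : 0 < p u -> \sum_(v : m.-tuple A) lik c u v = 1.
Proof.
move=> pu; elim: m u pu => [|m IH] u pu.
  by rewrite (big_tuple_nil _ (fun v => lik c u v)).
rewrite (big_tuple_cons _ _ (fun v => lik c u v)) -(sum_cond pu) /=.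
apply: eq_bigr => a _; rewrite -mulr_sumr.
have := cond_ge0 u a; rewrite le_eqVlt => /predU1P[<-|/cond_gt0 h]; first by rewrite mul0r.
by rewrite IH // mulr1.
Qed.

Variables (D rho : R).
Hypotheses (D_gt0 : 0 < D) (rho_gt0 : 0 < rho) (rho_lt1 : rho < 1).
Hypothesis cont : forall x w, 0 < p (x ++ w) ->
  \sum_a `|c (x ++ w) a - c w a| <= 2 * D * rho ^+ size w.

Lemma cond_close x x' w : 0 < p (x ++ w) -> 0 < p (x' ++ w) ->
  \sum_a `|c (x ++ w) a - c (x' ++ w) a| <= 4 * D * rho ^+ size w.
Proof.
move=> px px'.
have -> : 4 * D * rho ^+ size w = 2 * D * rho ^+ size w + 2 * D * rho ^+ size w by ring.
apply: le_trans (lerD (cont px) (cont px')).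
rewrite -big_split /=; apply: ler_sum => a _.
by rewrite [X in _ <= _ + X]distrC; apply: le_trans (ler_normD _ _); rewrite addrA subrK.
Qed.

Lemma sum_min u u' : 0 < p u -> 0 < p u' ->
  \sum_a Num.min (c u a) (c u' a) = 1 - 2^-1 * \sum_a `|c u a - c u' a|.
Proof.
move=> pu pu'.
have {1}-> : 1 = 2^-1 * (\sum_a c u a + \sum_a c u' a) :> R.
  by rewrite !sum_cond //; field.
rewrite -mulrBr -big_split -sumrB mulr_sumr /=; apply: eq_bigr => a _.
have [h|h] := leP (c u a) (c u' a).
  by rewrite ler0_norm ?subr_le0 //; field.
by rewrite gtr0_norm ?subr_gt0 //; field.
Qed.

(* Couple the next symbols maximally: on the common part the two histories
   are extended by the same letter. *)
Lemma step_cond_close f (e : A -> R) (b : R) u u' : 0 < p u -> 0 < p u' ->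
  (forall a, 0 < p (rcons u a) -> 0 < p (rcons u' a) ->
     `|f (rcons u a) - f (rcons u' a)| <= e a) ->
  (forall v v', 0 < p v -> 0 < p v' -> `|f v - f v'| <= b) ->
  `|step c f u - step c f u'| <=
    \sum_a Num.min (c u a) (c u' a) * e a + (1 - \sum_a Num.min (c u a) (c u' a)) * b.
Proof.
move=> pu pu' fe fb; pose m a := Num.min (c u a) (c u' a).
have m0 a : 0 <= m a by rewrite le_min !cond_ge0.
have mu a : m a <= c u a by rewrite ge_min lexx.
have mu' a : m a <= c u' a by rewrite ge_min lexx orbT.
have -> : step c f u - step c f u' =
   \sum_a m a * (f (rcons u a) - f (rcons u' a)) +
   (\sum_a (c u a - m a) * f (rcons u a) - \sum_a (c u' a - m a) * f (rcons u' a)).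
  by rewrite /step -!sumrB -big_split /=; apply: eq_bigr => a _; ring.
apply: le_trans (ler_normD _ _) _; apply: lerD.
  apply: le_trans (ler_norm_sum _ _ _) _; apply: ler_sum => a _.
  rewrite normrM ger0_norm //.
  have := m0 a; rewrite le_eqVlt => /predU1P[ma|ma]; first by rewrite -/(m a) -ma !mul0r.
  apply: ler_wpM2l => //; apply: fe; apply: cond_gt0.
    exact: lt_le_trans ma (mu a).
  exact: lt_le_trans ma (mu' a).
apply: weighted_sum_close.
- by move=> a; rewrite subr_ge0.
- by move=> a; rewrite subr_ge0.
- by rewrite sumrB sum_cond.
- by rewrite sumrB sum_cond.
- move=> i j hi hj; apply: fb; apply: cond_gt0.
    by apply: lt_le_trans hi _; rewrite gerBl.
  by apply: lt_le_trans hj _; rewrite gerBl.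
Qed.

Lemma step_cond_osc f (b : R) :
  (forall v v', 0 < p v -> 0 < p v' -> `|f v - f v'| <= b) ->
  forall v v', 0 < p v -> 0 < p v' -> `|step c f v - step c f v'| <= b.
Proof.
move=> fb u u' pu pu'.
have := @step_cond_close f (fun=> b) b u u' pu pu' (fun a h h' => fb _ _ h h') fb.
by rewrite /= -mulr_suml -mulrDl subrKC mul1r.
Qed.

Lemma iter_step_cond_osc n f (b : R) :
  (forall v v', 0 < p v -> 0 < p v' -> `|f v - f v'| <= b) ->
  forall v v', 0 < p v -> 0 < p v' -> `|iter n (step c) f v - iter n (step c) f v'| <= b.
Proof. by move=> fb; elim: n => //= n IH; apply: step_cond_osc. Qed.

(** Under the maximal coupling a mismatch after the common suffix [w] has mass at most 2 D rho^|w|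
    and costs at most 2, while a match lengthens the suffix by one letter. The costs form a
    geometric series, so the bound does not depend on [N]. *)
Lemma iter_step_cond_close N k f : (forall v v', 0 < p v -> 0 < p v' -> `|f v - f v'| <= 2) ->
  (forall x x' w, 0 < p (x ++ w) -> 0 < p (x' ++ w) -> (k <= size w)%N ->
    `|f (x ++ w) - f (x' ++ w)| <= 4 * D * rho ^+ size w) ->
  forall x x' w, 0 < p (x ++ w) -> 0 < p (x' ++ w) -> (k <= size w)%N ->
    `|iter N (step c) f (x ++ w) - iter N (step c) f (x' ++ w)| <=
      4 * D / (1 - rho) * rho ^+ size w.
Proof.
move=> f2 fk; have r1 : 0 < 1 - rho by rewrite subr_gt0.
elim: N => [|N IH] x x' w px px' kw /=.
  apply: le_trans (fk _ _ _ px px' kw) _; apply: ler_wpM2r; first exact/exprn_ge0/ltW.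
  rewrite ler_pdivlMr // ler_piMr ?mulr_ge0 // ?gerBl ?ltW //.
apply: le_trans (step_cond_close (e := fun=> 4 * D / (1 - rho) * rho ^+ (size w).+1) (b := 2) px px' _ _) _.
- move=> a; rewrite !rcons_cat => h h'.
  by rewrite -(size_rcons w a); apply: IH => //; rewrite size_rcons ltnW.
- exact: iter_step_cond_osc.
rewrite -mulr_suml sum_min //.
have cl := cond_close px px'; set s := \sum_a _ in cl *.
have s0 : 0 <= s by apply: sumr_ge0.
have E0 : 0 <= 4 * D / (1 - rho) * rho ^+ (size w).+1.
  by rewrite !mulr_ge0 ?invr_ge0 ?exprn_ge0 ?ltW.
have -> : 4 * D / (1 - rho) * rho ^+ size w =
  4 * D * rho ^+ size w + 4 * D / (1 - rho) * rho ^+ (size w).+1.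
  by rewrite exprS; field; rewrite gt_eqF.
have : (1 - 2^-1 * s) * (4 * D / (1 - rho) * rho ^+ (size w).+1) <=
   4 * D / (1 - rho) * rho ^+ (size w).+1.
  by apply: ler_piMl => //; lra.
by lra.
Qed.

(* A lower bound for the common mass of the laws of the next [s] letters after
   the histories [u] and [u']: the one-step couplings are chained. *)
Fixpoint overlap s u u' : R :=
  if s is s'.+1 then
    \sum_a Num.min (c u a) (c u' a) * overlap s' (rcons u a) (rcons u' a)
  else 1.

Lemma le_overlapS s u u' (b : A -> R) :
  (forall a, 0 < p (rcons u a) -> 0 < p (rcons u' a) ->
    b a <= overlap s (rcons u a) (rcons u' a)) ->
  \sum_a Num.min (c u a) (c u' a) * b a <= overlap s.+1 u u'.
Proof.
move=> hb /=; apply: ler_sum => a _.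
have := cond_ge0 u a; rewrite le_eqVlt => /predU1P[<-|ca].
  by rewrite min_l ?cond_ge0 // !mul0r.
have := cond_ge0 u' a; rewrite le_eqVlt => /predU1P[<-|ca'].
  by rewrite min_r ?cond_ge0 // !mul0r.
by apply: ler_wpM2l; [rewrite le_min !cond_ge0|apply: hb; apply: cond_gt0].
Qed.

(* Once the histories agree on their last letters, each further match makes
   the next one likelier, so that the failure probabilities are summable. *)
Lemma overlap_agree s x x' w : 0 < p (x ++ w) -> 0 < p (x' ++ w) ->
  1 - 2 * D / (1 - rho) * rho ^+ size w <= overlap s (x ++ w) (x' ++ w).
Proof.
have r1 : 0 < 1 - rho by rewrite subr_gt0.
elim: s x x' w => [|s IH] x x' w px px'.
  by rewrite /= gerBl !mulr_ge0 ?invr_ge0 ?exprn_ge0 ?ltW.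
apply: le_trans (@le_overlapS s _ _ (fun=> 1 - 2 * D / (1 - rho) * rho ^+ (size w).+1) _); last first.
  by move=> a; rewrite !rcons_cat => h h'; rewrite -(size_rcons w a); apply: IH.
rewrite -mulr_suml sum_min //.
have cl := cond_close px px'; set t := \sum_a _ in cl *.
set r := rho ^+ size w in cl *.
have r0 : 0 < r by apply: exprn_gt0.
have E : 2 * D / (1 - rho) * r = 2 * D * r + 2 * D / (1 - rho) * rho ^+ (size w).+1.
  by rewrite exprS -/r; field; rewrite gt_eqF.
have t0 : 0 <= t by apply: sumr_ge0.
rewrite E; set G := _ * rho ^+ _.
have G0 : 0 <= G by rewrite !mulr_ge0 ?invr_ge0 ?exprn_ge0 ?ltW.
have tb : 2^-1 * t <= 2 * D * r by move: cl; lra.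
have b0 : 0 <= 2^-1 * t by rewrite mulr_ge0.
have t2 : 2^-1 * t <= 1.
  suff : t <= 2 by lra.
  have -> : 2 = \sum_a c (x ++ w) a + \sum_a c (x' ++ w) a by rewrite !sum_cond.
  rewrite -big_split; apply: ler_sum => a _.
  by apply: le_trans (ler_normB _ _) _; rewrite !ger0_norm ?cond_ge0.
by nra.
Qed.

Variable al : A -> R.
Hypotheses (al_le : forall u a, 0 < p u -> al a <= c u a) (al_gt0 : 0 < \sum_a al a).

Lemma sum_min_ge u u' : 0 < p u -> 0 < p u' ->
  \sum_a al a <= \sum_a Num.min (c u a) (c u' a).
Proof. by move=> pu pu'; apply: ler_sum => a _; rewrite le_min !al_le. Qed.

(** From arbitrary histories, non-nullness matches each of [K] letters with mass at least the sum of
    [al]; with [K] letters in common, [overlap_agree] keeps at least one half for ever. *)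
Lemma overlap_uniform : exists2 th, 0 < th <= 1 &
  forall s u u', 0 < p u -> 0 < p u' -> th <= overlap s u u'.
Proof.
have al'_gt0 := al_gt0; set al' := \sum_a al a in al'_gt0; have r1 : 0 < 1 - rho by rewrite subr_gt0.
have al1 : al' <= 1.
  rewrite -[leRHS](sum_cond (u := [::])) ?p_nil //.
  by apply: ler_sum => a _; apply: al_le; rewrite p_nil.
have [K hK] : exists K, 2 * D / (1 - rho) * rho ^+ K <= 2^-1.
  have G0 : 0 < 2 * D / (1 - rho) by rewrite !mulr_gt0 ?invr_gt0.
  have h := @cvg_expr R rho; rewrite gtr0_norm // in h.
  have /cvgrPdist_le/(_ (2^-1 / (2 * D / (1 - rho)))) := h rho_lt1.
  rewrite divr_gt0 // => /(_ isT)[K _ /(_ K (leqnn K))] /=.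
  rewrite sub0r normrN (ger0_norm (exprn_ge0 _ (ltW rho_gt0))) ler_pdivlMr // mulrC => hK.
  by exists K.
(* [i] bounds the number of letters still to be matched before the common suffix reaches length
   [K]. *)
have key i s x x' w : 0 < p (x ++ w) -> 0 < p (x' ++ w) -> (K <= i + size w)%N ->
    al' ^+ i * 2^-1 <= overlap s (x ++ w) (x' ++ w).
  elim: i s x x' w => [|i IH] s x x' w px px' Kw.
    rewrite expr0 mul1r; apply: le_trans (overlap_agree s px px').
    rewrite lerBrDl; apply: (@le_trans _ _ (2^-1 + 2^-1)); last by lra.
    rewrite lerD2r; apply: le_trans hK; apply: ler_wpM2l.
      by rewrite !mulr_ge0 ?invr_ge0 ?ltW.
    by apply: ler_wiXn2l => //; rewrite ltW.
  have a1 j : al' ^+ j <= 1 by apply: exprn_ile1 => //; exact: ltW al'_gt0.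
  have a0 j : 0 <= al' ^+ j by apply: exprn_ge0; exact: ltW al'_gt0.
  case: s => [|s]; first by rewrite /=; have := a1 i.+1; lra.
  apply: le_trans (@le_overlapS s _ _ (fun=> al' ^+ i * 2^-1) _); last first.
    by move=> a; rewrite !rcons_cat => h h'; apply: IH => //; rewrite size_rcons addnS.
  rewrite -mulr_suml exprS -mulrA; apply: ler_wpM2r; first by rewrite mulr_ge0.
  exact: sum_min_ge.
exists (al' ^+ K * 2^-1).
  rewrite mulr_gt0 ?exprn_gt0 //=.
  by have := exprn_ile1 K (ltW al'_gt0) al1; lra.
by move=> s u u' pu pu'; have := key K s u u' [::]; rewrite !cats0; apply; rewrite ?addn0.
Qed.

(* After [s0] matched letters the two histories agree long enough for the
   difference to be at most [e]; with the remaining mass nothing is lost. *)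
Lemma iter_step_cond_contract s0 s f (b e : R) :
  (forall v v', 0 < p v -> 0 < p v' -> `|f v - f v'| <= b) ->
  (forall x x' w, 0 < p (x ++ w) -> 0 < p (x' ++ w) -> (s0 <= size w)%N ->
    `|f (x ++ w) - f (x' ++ w)| <= e) ->
  forall x x' w, 0 < p (x ++ w) -> 0 < p (x' ++ w) -> (s0 <= s + size w)%N ->
    `|iter s (step c) f (x ++ w) - iter s (step c) f (x' ++ w)| <=
      (1 - overlap s (x ++ w) (x' ++ w)) * b + overlap s (x ++ w) (x' ++ w) * e.
Proof.
move=> fb fe; elim: s => [|s IH] x x' w px px' sw /=.
  by rewrite subrr mul0r add0r mul1r; apply: fe.
set o := fun a => overlap s (rcons (x ++ w) a) (rcons (x' ++ w) a).
apply: le_trans (step_cond_close (e := fun a => (1 - o a) * b + o a * e) (b := b) px px' _ _) _.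
- by move=> a; rewrite /o !rcons_cat => h h'; apply: IH => //; rewrite size_rcons addnS.
- exact: iter_step_cond_osc.
pose m a := Num.min (c (x ++ w) a) (c (x' ++ w) a).
have E : \sum_a m a * ((1 - o a) * b + o a * e) =
    (\sum_a m a - \sum_a m a * o a) * b + (\sum_a m a * o a) * e.
  by rewrite -sumrB !mulr_suml -big_split /=; apply: eq_bigr => a _; ring.
have E' (S T : R) : (S - T) * b + T * e + (1 - S) * b = (1 - T) * b + T * e by ring.
by have := lexx ((1 - \sum_a m a * o a) * b + (\sum_a m a * o a) * e);
  rewrite -{1}(E' (\sum_a m a)) -E.
Qed.

(** In each round of [s0] letters, mass at least [th] is matched throughout and leaves a difference
    of at most [e]; on the rest the oscillation does not grow. This gives the recursion [B] to
    [(1 - th) * B + th * e] over [J] rounds. *)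
Lemma iter_step_cond_mix th s0 f : 0 <= th <= 1 ->
  (forall u u', 0 < p u -> 0 < p u' -> th <= overlap s0 u u') ->
  (forall v v', 0 < p v -> 0 < p v' -> `|f v - f v'| <= 2) ->
  (forall x x' w, 0 < p (x ++ w) -> 0 < p (x' ++ w) -> (s0 <= size w)%N ->
    `|f (x ++ w) - f (x' ++ w)| <= 4 * D * rho ^+ size w) ->
  forall J u u', 0 < p u -> 0 < p u' ->
    th * `|iter (J * s0) (step c) f u - iter (J * s0) (step c) f u'| <=
      2 * (1 - th) ^+ J + 4 * D / (1 - rho) * rho ^+ s0.
Proof.
move=> /andP[th0 th1] hth f2 fk; set e := 4 * D / (1 - rho) * rho ^+ s0.
have r1 : 0 < 1 - rho by rewrite subr_gt0.
have e0 : 0 <= e by rewrite !mulr_ge0 ?invr_ge0 ?exprn_ge0 ?ltW.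
(* One [e] serves all rounds: the modulus of the iterates is bounded uniformly in their number. *)
have fN N : forall x x' w, 0 < p (x ++ w) -> 0 < p (x' ++ w) -> (s0 <= size w)%N ->
    `|iter N (step c) f (x ++ w) - iter N (step c) f (x' ++ w)| <= e.
  move=> x x' w px px' sw; apply: le_trans (iter_step_cond_close N f2 fk px px' sw) _.
  apply: ler_wpM2l; first by rewrite !mulr_ge0 ?invr_ge0 ?ltW.
  by apply: ler_wiXn2l => //; rewrite ltW.
clearbody e.
have key J : exists2 B, 0 <= B /\ th * B <= 2 * (1 - th) ^+ J + e &
    forall u u', 0 < p u -> 0 < p u' ->
    `|iter (J * s0) (step c) f u - iter (J * s0) (step c) f u'| <= B.
  elim: J => [|J [B [B0 hB] IH]].
    by exists 2 => //; rewrite expr0; split => //; lra.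
  exists ((1 - th) * B + th * e).
    split; first by rewrite addr_ge0 ?mulr_ge0 ?subr_ge0.
    have h1 : (1 - th) * (th * B) <= (1 - th) * (2 * (1 - th) ^+ J + e).
      by apply: ler_wpM2l; rewrite ?subr_ge0.
    have h2 : th * (th * e) <= th * (1 * e).
      by apply: ler_wpM2l => //; apply: ler_wpM2r.
    by rewrite exprS; move: h1 h2; move: ((1 - th) ^+ J) => X h1 h2; lra.
  move=> u u' pu pu'; rewrite mulSn iterD.
  pose f' := iter (J * s0) (step c) f.
  (* The overlap may exceed [th]. With [Num.min e B] in place of [e] the bound decreases in the
     overlap, which can then be lowered to [th]. *)
  have := @iter_step_cond_contract s0 s0 f' B (Num.min e B) IH _ u u' [::].
  rewrite !cats0 => /(_ _ pu pu').
  have h x x' w : 0 < p (x ++ w) -> 0 < p (x' ++ w) -> (s0 <= size w)%N ->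
    `|f' (x ++ w) - f' (x' ++ w)| <= Num.min e B.
    by move=> px px' sw; rewrite le_min fN // IH.
  rewrite addn0 => /(_ h (leqnn _)) /le_trans; apply.
  have := hth _ _ pu pu'; set o := overlap _ _ _ => oth.
  have me : Num.min e B <= e by rewrite ge_min lexx.
  have mB : Num.min e B <= B by rewrite ge_min lexx orbT.
  have h1 : (o - th) * (Num.min e B) <= (o - th) * B.
    by apply: ler_wpM2l; rewrite ?subr_ge0.
  have h2 : th * Num.min e B <= th * e by apply: ler_wpM2l.
  by nra.
move=> J u u' pu pu'; have [B [B0 hB] /(_ u u' pu pu') h] := key J.
by apply: le_trans hB; apply: ler_wpM2l.
Qed.

(** * Testing the process against Markov chains *)

Section MarkovAlternative.
Variables (k : nat) (gk : R) (q : seq A -> A -> R).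
Hypotheses (q_ge0 : forall u a, 0 <= q u a) (q_sum : forall u, \sum_a q u a <= 1).
Hypothesis q_dep : forall x w a, (k <= size w)%N -> q (x ++ w) a = q w a.
Hypothesis gap : forall x w, size w = k -> 0 < p (x ++ w) ->
  gk - D * rho ^+ size (x ++ w) <= \sum_a `|c (x ++ w) a - c w a|.

Definition disc u : R := \sum_a `|c u a - q u a|.

Lemma disc_osc v v' : 0 < p v -> 0 < p v' -> `|disc v - disc v'| <= 2.
Proof.
move=> _ _; have d0 u : 0 <= disc u by apply: sumr_ge0.
have d2 u : disc u <= 2.
  apply: (@le_trans _ _ (\sum_a c u a + \sum_a q u a)).
    rewrite -big_split; apply: ler_sum => a _.
    by apply: le_trans (ler_normB _ _) _; rewrite !ger0_norm ?cond_ge0.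
  by have := sum_cond_le1 u; have := q_sum u; rewrite /c; lra.
by rewrite ler_norml; have := d0 v; have := d0 v'; have := d2 v; have := d2 v'; lra.
Qed.

Lemma disc_close x x' w : 0 < p (x ++ w) -> 0 < p (x' ++ w) -> (k <= size w)%N ->
  `|disc (x ++ w) - disc (x' ++ w)| <= 4 * D * rho ^+ size w.
Proof.
move=> px px' kw; apply: le_trans (cond_close px px').
rewrite -sumrB; apply: le_trans (ler_norm_sum _ _ _) _; apply: ler_sum => a _.
apply: le_trans (ler_dist_dist _ _) _.
by rewrite !q_dep // opprB addrA subrK.
Qed.

(* Averaging over the letters before the last k cannot increase the distance
   to [q], which does not see them; so [q] cannot be close to the process
   without the k-step conditional probabilities being close to it too. *)
Lemma iter_disc_ge N : (k <= N)%N -> gk - D * rho ^+ N <= 2 * iter N (step c) disc [::].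
Proof.
move=> kN; have -> : N = ((N - k) + k)%N by rewrite subnK.
move: (N - k)%N => m; set n := (m + k)%N.
rewrite iter_step; under eq_bigr do rewrite -law_likE.
rewrite (big_tuple_cat _ _ _ (fun v => p v * disc v)).
set S := \sum_(u : m.-tuple A) _.
have S2 : \sum_(w : k.-tuple A) p w * disc w <= S.
  rewrite /S exchange_big /=; apply: ler_sum => w _.
  rewrite /disc mulr_sumr; under [leRHS]eq_bigr do rewrite mulr_sumr.
  rewrite exchange_big /=; apply: ler_sum => a _.
  rewrite -{1}(ger0_norm (p_ge0 w)) -normrM mulrBr -law_condE.
  rewrite -(sum_law_cat m) -(sum_law_cat m w) mulr_suml -sumrB.
  apply: le_trans (ler_norm_sum _ _ _) _; apply: ler_sum => x _.
  by rewrite -rcons_cat law_condE q_dep ?size_tuple // -mulrBr normrM ger0_norm.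
(* The factor 2: the gap is split by the triangle inequality at [q], and both the distance at the
   full history and the averaged one are at most [S]. *)
apply: (@le_trans _ _ (S + \sum_(w : k.-tuple A) p w * disc w)); last by lra.
have -> : \sum_(w : k.-tuple A) p w * disc w =
    \sum_(x : m.-tuple A) \sum_(w : k.-tuple A) p (x ++ w) * disc w.
  rewrite exchange_big /=; apply: eq_bigr => w _.
  by rewrite -mulr_suml sum_law_cat.
have -> : gk - D * rho ^+ n =
    \sum_(x : m.-tuple A) \sum_(w : k.-tuple A) p (x ++ w) * (gk - D * rho ^+ n).
  under eq_bigr do rewrite -mulr_suml.
  by rewrite -mulr_suml -(big_tuple_cat _ _ _ p) sum_law mul1r.
rewrite -big_split /=; apply: ler_sum => x _.
rewrite -big_split /=; apply: ler_sum => w _.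
rewrite -mulrDr; have := p_ge0 (x ++ w); rewrite le_eqVlt => /predU1P[<-|pxw].
  by rewrite !mul0r.
apply: ler_wpM2l => //.
have -> : n = size (x ++ w) by rewrite size_cat !size_tuple.
apply: le_trans (gap (size_tuple w) pxw) _.
rewrite /disc -big_split /=; apply: ler_sum => a _.
rewrite q_dep ?size_tuple // [X in _ <= _ + X]distrC.
by apply: le_trans (ler_normD _ _); rewrite addrA subrK.
Qed.

Let h u a := Num.sqrt (c u a * q u a).

Lemma affinity_le1 u : \sum_a h u a <= 1.
Proof.
apply: (@le_trans _ _ (2^-1 * (\sum_a c u a + \sum_a q u a))); last first.
  by have := sum_cond_le1 u; have := q_sum u; rewrite /c; lra.
rewrite -big_split mulr_sumr /=; apply: ler_sum => a _.
rewrite /h sqrtrM ?cond_ge0 //.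
rewrite -{2}(sqr_sqrtr (cond_ge0 u a)) -{2}(sqr_sqrtr (q_ge0 u a)).
set X := Num.sqrt _; set Y := Num.sqrt _.
by have := sqr_ge0 (X - Y); rewrite /X /Y /c; nra.
Qed.

Lemma affinity_anti m u : iter m.+1 (step h) (fun=> 1) u <= iter m (step h) (fun=> 1) u.
Proof.
rewrite -addn1 iterD; apply: iter_step_le => [v a|v _]; first exact: sqrtr_ge0.
rewrite /= /step; under eq_bigr do rewrite mulr1.
exact: affinity_le1.
Qed.

Lemma sum_lik_dist m u (lam : R) : 0 < p u -> 0 < lam ->
  \sum_(v : m.-tuple A) `|lik c u v - lik q u v| <=
    lam * (1 - iter m (step h) (fun=> 1) u) + 2 / lam.
Proof.
move=> pu lam0; rewrite iter_step; under [X in _ - X]eq_bigr do rewrite mulr1.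
have E : \sum_(v : m.-tuple A) lik h u v =
    \sum_(v : m.-tuple A) Num.sqrt (lik c u v * lik q u v).
  by apply: eq_bigr => v _; rewrite lik_sqrt //; apply: cond_ge0.
rewrite E; have sq := sum_lik_le1 m u q_ge0 q_sum.
apply: (@le_trans _ _ (lam * 2^-1 * (\sum_(v : m.-tuple A) lik c u v +
   \sum_(v : m.-tuple A) lik q u v - 2 * \sum_(v : m.-tuple A) Num.sqrt (lik c u v * lik q u v))
   + lam^-1 * (\sum_(v : m.-tuple A) lik c u v + \sum_(v : m.-tuple A) lik q u v))); last first.
  rewrite sum_lik_cond //; apply: lerD; last first.
    by rewrite mulrC ler_pM2r ?invr_gt0 //; lra.
  by rewrite -mulrA ler_pM2l //; lra.
rewrite -big_split mulr_sumr -sumrB !mulr_sumr -big_split /=; apply: ler_sum => v _.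
have C0 : 0 <= lik c u v by apply/lik_ge0/cond_ge0.
have Q0 : 0 <= lik q u v by apply/lik_ge0.
exact: dist_le_affinity.
Qed.

(** A discrepancy in predicting the last letter shows in the joint laws: with C and Q the
    likelihoods, C(v) (c - q) = (C(va) - Q(va)) - (C(v) - Q(v)) q. Two distances appear, for m + 1
    and for m letters, and the affinity decreases with the length. *)
Lemma iter_disc_le m u (lam : R) : 0 < p u -> 0 < lam ->
  iter m (step c) disc u <=
    2 * (lam * (1 - iter m.+1 (step h) (fun=> 1) u) + 2 / lam).
Proof.
move=> pu lam0; have h1 := sum_lik_dist m.+1 pu lam0; have h2 := sum_lik_dist m pu lam0.
have an : lam * (1 - iter m (step h) (fun=> 1) u) <= lam * (1 - iter m.+1 (step h) (fun=> 1) u).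
  by rewrite ler_pM2l // lerB // affinity_anti.
apply: (@le_trans _ _ (\sum_(v : m.+1.-tuple A) `|lik c u v - lik q u v| +
   \sum_(v : m.-tuple A) `|lik c u v - lik q u v|)); last by move: h1 h2 an; lra.
rewrite iter_step (big_tuple_rcons _ _ (fun v => `|lik c u v - lik q u v|)).
rewrite -big_split /=; apply: ler_sum => v _.
rewrite /disc mulr_sumr.
apply: (@le_trans _ _ (\sum_a (`|lik c u (rcons v a) - lik q u (rcons v a)| +
   `|lik c u v - lik q u v| * q (u ++ v) a))); last first.
  rewrite big_split /= lerD2l -mulr_sumr.
  by rewrite -[leRHS]mulr1; apply: ler_wpM2l.
apply: ler_sum => a _; rewrite !lik_rcons.
have C0 : 0 <= lik c u v by apply/lik_ge0/cond_ge0.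
rewrite -{1}(ger0_norm C0) -normrM -[X in _ + `|_| * X](ger0_norm (q_ge0 _ _)) -normrM.
rewrite [X in _ + `|X|]mulrBl [X in _ <= _ + X]distrC.
rewrite mulrBr; set z := lik q u v * _.
have -> : lik c u v * c (u ++ v) a - lik c u v * q (u ++ v) a =
  (lik c u v * c (u ++ v) a - z) + (z - lik c u v * q (u ++ v) a) by ring.
exact: ler_normD.
Qed.

(** Started from the empty history the mean discrepancy is at least gk / 4; mixing transfers it to
    any history with a loss of gk / 8, and [iter_disc_le] turns the remaining gk / 8 into a loss of
    affinity. *)
Lemma affinity_block th s0 J u : 0 < th <= 1 ->
  (forall u u', 0 < p u -> 0 < p u' -> th <= overlap s0 u u') ->
  (k <= s0)%N -> (0 < J)%N -> 0 < gk ->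
  2 * (1 - th) ^+ J + 4 * D / (1 - rho) * rho ^+ s0 <= th * (gk / 8) ->
  D * rho ^+ (J * s0) <= gk / 2 ->
  iter (J * s0).+1 (step h) (fun=> 1) u <= 1 - (gk / 64) ^+ 2.
Proof.
move=> /andP[th0 th1] hth ks J0 g0 h1 h2; set T := (J * s0)%N.
have kT : (k <= T)%N by apply: leq_trans ks _; rewrite leq_pmull.
have d0 : gk / 4 <= iter T (step c) disc [::].
  by have := iter_disc_ge kT; move: h2; lra.
have mix v : 0 < p v -> gk / 8 <= iter T (step c) disc v.
  move=> pv.
  have th01 : 0 <= th <= 1 by rewrite ltW.
  have dk x x' w : 0 < p (x ++ w) -> 0 < p (x' ++ w) -> (s0 <= size w)%N ->
      `|disc (x ++ w) - disc (x' ++ w)| <= 4 * D * rho ^+ size w.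
    by move=> px px' sw; apply: disc_close => //; apply: leq_trans sw.
  have := iter_step_cond_mix th01 hth disc_osc dk J pv (u' := [::]).
  rewrite p_nil => /(_ ltr01) /le_trans /(_ h1).
  by rewrite ler_pM2l // ler_norml => /andP[]; rewrite -/T; lra.
have main v : 0 < p v -> iter T.+1 (step h) (fun=> 1) v <= 1 - (gk / 64) ^+ 2.
  (* This [lam] makes the error term 4 / lam equal to gk / 16, half of the available gk / 8. *)
  move=> pv; have lam0 : 0 < 64 / gk by rewrite divr_gt0.
  have := le_trans (mix v pv) (iter_disc_le T pv lam0).
  rewrite invf_div -(ler_pM2l g0) => hh.
  have E : gk * (2 * (64 / gk * (1 - iter T.+1 (step h) (fun=> 1) v) + 2 * (gk / 64))) =
     128 * (1 - iter T.+1 (step h) (fun=> 1) v) + gk ^+ 2 / 16.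
    by field; rewrite gt_eqF.
  by move: hh (sqr_ge0 gk); rewrite E; move: (iter _ _ _ _) => X; rewrite !expr2; lra.
(* At a null history the affinity is 0, and the right side is nonnegative by the bound at the empty
   word. *)
have := p_ge0 u; rewrite le_eqVlt => /predU1P[pu0|]; last exact: main.
apply: (@le_trans _ _ 0).
  rewrite /= /step big1 // => a _.
  by rewrite /h cond_eq0 ?mul0r ?sqrtr0 ?mul0r.
apply: le_trans (main [::] _); last by rewrite p_nil.
by apply: iter_step_ge0 => // v a; apply: sqrtr_ge0.
Qed.

(** Markov's inequality for sqrt (q / P): on the event this ratio is at least exp (- t), whence the
    factor 2 in the threshold. The letters left over after [M] blocks contribute an affinity of at
    most 1. *)
Lemma likelihood_ratio_test (T M k0 n : nat) (b t : R) :
  (forall u, (k0 <= size u)%N -> iter T (step h) (fun=> 1) u <= b) -> 0 <= b ->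
  (M * T <= n)%N ->
  \sum_(u : k0.-tuple A) \sum_(v : n.-tuple A |
     expR (- (2 * t)) * lik c u v <= lik q u v) p (u ++ v) <= expR t * b ^+ M.
Proof.
move=> hb b0 MT.
have h0 v a : 0 <= h v a by apply: sqrtr_ge0.
have hn (u : k0.-tuple A) : \sum_(v : n.-tuple A) lik h u v <= b ^+ M.
  have -> : \sum_(v : n.-tuple A) lik h u v = iter n (step h) (fun=> 1) u.
    by rewrite iter_step; apply: eq_bigr => v _; rewrite mulr1.
  rewrite -(subnKC MT) iterD.
  apply: (@le_trans _ _ (iter (M * T) (step h) (fun=> 1) u)).
    by apply: iter_step_le => // v _; apply: iter_step_le1 => //; apply: affinity_le1.
  by apply: (@iter_step_block _ _ h k0) => //; rewrite size_tuple.
apply: (@le_trans _ _ (\sum_(u : k0.-tuple A) p u * (expR t * b ^+ M))); last first.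
  by rewrite -mulr_suml sum_law mul1r.
apply: ler_sum => u _; under eq_bigr do rewrite law_lik.
rewrite -mulr_sumr; apply: ler_wpM2l => //.
apply: (@le_trans _ _ (expR t * \sum_(v : n.-tuple A) lik h u v)); last first.
  by apply: ler_wpM2l; [apply: expR_ge0|apply: hn].
rewrite mulr_sumr [leRHS](bigID (fun v : n.-tuple A => expR (- (2 * t)) * lik c u v <= lik q u v)) /=.
rewrite -[leLHS]addr0; apply: lerD; last first.
  by apply: sumr_ge0 => v _; rewrite mulr_ge0 ?expR_ge0 // lik_ge0.
apply: ler_sum => v hv; rewrite lik_sqrt //; last by move=> w a; apply: cond_ge0.
have C0 : 0 <= lik c u v by apply/lik_ge0/cond_ge0.
have Q0 : 0 <= lik q u v by apply/lik_ge0.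
rewrite -(ler_pXn2r (n := 2)) ?nnegrE ?mulr_ge0 ?expR_ge0 ?sqrtr_ge0 //.
rewrite exprMn sqr_sqrtr ?mulr_ge0 // mulrCA expr2; apply: ler_wpM2l => //.
rewrite -expRM_natl -ler_pdivrMl ?expR_gt0 // -expRN.
exact: hv.
Qed.

End MarkovAlternative.

(** * Chi-square approximation by smoothed Markov chains *)

Section SmoothedMarkov.
Variables (k0 : nat) (e : R).
Hypotheses (A_gt0 : (0 < #|A|)%N) (e_gt0 : 0 < e) (e_le1 : e <= 1).
Hypothesis eE : e = D * rho ^+ k0.

(* The k0-step Markov approximation of the process, mixed with the uniform
   distribution: conditional probabilities may vanish, and the chi-square
   distance below needs a lower bound on the denominator. *)
Definition smooth_cond u a : R := (1 - e) * c (lastn k0 u) a + e / #|A|%:R.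
Let Q := smooth_cond.

Lemma smooth_cond_dep x w a : (k0 <= size w)%N -> Q (x ++ w) a = Q w a.
Proof. by move=> kw; rewrite /Q /smooth_cond lastn_cat. Qed.

Let cardA_gt0 : 0 < #|A|%:R :> R. Proof. by rewrite ltr0n. Qed.

Lemma smooth_cond_ge u a : e / #|A|%:R <= Q u a.
Proof. by rewrite lerDr mulr_ge0 ?cond_ge0 // subr_ge0. Qed.

Lemma smooth_cond_gt0 u a : 0 < Q u a.
Proof. by apply: lt_le_trans (smooth_cond_ge u a); rewrite divr_gt0. Qed.

Let sum_uniform : \sum_(a : A) e / #|A|%:R = e.
Proof. by rewrite sumr_const -[LHS]mulr_natr divfK // gt_eqF. Qed.

Lemma sum_smooth_cond_le1 u : \sum_a Q u a <= 1.
Proof.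
rewrite big_split /= sum_uniform -mulr_sumr.
have := sum_cond_le1 (lastn k0 u); rewrite -/c; set s := \sum_a _ => s1.
have : (1 - e) * s <= (1 - e) * 1 by apply: ler_wpM2l; rewrite ?subr_ge0.
by lra.
Qed.

(** With d = c - Q one has c^2 / Q = Q + 2 d + d^2 / Q, and the linear term sums to 0. Continuity
    and smoothing each contribute 2 e to the sum of |d|, so the last term is at most (4 e)^2 |A| /
    e: a smoothing weight equal to the continuity rate keeps it of first order in [e]. *)
Lemma smooth_chi2 u : (k0 <= size u)%N ->
  \sum_a c u a ^+ 2 / Q u a <= 1 + 16 * #|A|%:R * e.
Proof.
move=> ku; have bnd0 : 0 <= 16 * #|A|%:R * e by rewrite !mulr_ge0 // ltW.
have := p_ge0 u; rewrite le_eqVlt => /predU1P[pu0|pu].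
  by rewrite big1 ?addr_ge0 // => a _; rewrite cond_eq0 // expr0n mul0r.
have pw : 0 < p (lastn k0 u) by apply: (law_suffix_gt0 (x := take (size u - k0) u)); rewrite lastnK.
pose d a := c u a - Q u a.
have sQ : \sum_a Q u a = 1.
  by rewrite big_split /= sum_uniform -mulr_sumr sum_cond // mulr1 subrK.
have sd : \sum_a d a = 0 by rewrite sumrB sQ sum_cond // subrr.
have sad : \sum_a `|d a| <= 4 * e.
  have cl : \sum_a `|c u a - c (lastn k0 u) a| <= 2 * e.
    rewrite eE mulrA -{2}(size_lastn ku) -{1}(lastnK k0 u).
    by apply: cont; rewrite lastnK.
  apply: (@le_trans _ _ (\sum_a `|c u a - c (lastn k0 u) a| +
      \sum_a (e * c (lastn k0 u) a + e / #|A|%:R))); last first.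
    rewrite big_split /= sum_uniform -mulr_sumr sum_cond //; move: cl; lra.
  rewrite -big_split /=; apply: ler_sum => a _.
  have -> : d a = (c u a - c (lastn k0 u) a) + (e * c (lastn k0 u) a - e / #|A|%:R).
    by rewrite /d /Q /smooth_cond; ring.
  apply: le_trans (ler_normD _ _) _; rewrite lerD2l.
  apply: le_trans (ler_normB _ _) _; rewrite !ger0_norm //; first by rewrite divr_ge0 // ltW.
  by rewrite mulr_ge0 ?cond_ge0 // ltW.
have sad0 : 0 <= \sum_a `|d a| by apply: sumr_ge0.
have E a : c u a ^+ 2 / Q u a = Q u a + 2 * d a + d a ^+ 2 / Q u a.
  by rewrite /d; field; rewrite gt_eqF // smooth_cond_gt0.
under eq_bigr do rewrite E.
rewrite big_split /= [X in X + _ <= _]big_split /= sQ -mulr_sumr sd mulr0 addr0 lerD2l.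
apply: (@le_trans _ _ (\sum_a (`|d a| * (4 * e)) * (#|A|%:R / e))); last first.
  rewrite -!mulr_suml.
  have -> : 16 * #|A|%:R * e = (4 * e) * (4 * e) * (#|A|%:R / e).
    by field; rewrite gt_eqF.
  apply: ler_wpM2r; first by rewrite divr_ge0 // ltW.
  by apply: ler_wpM2r => //; rewrite mulr_ge0 // ltW.
apply: ler_sum => a _; rewrite -[d a ^+ 2]real_normK ?num_real //.
apply: ler_pM; rewrite ?exprn_ge0 ?invr_ge0 //.
- exact/ltW/smooth_cond_gt0.
- rewrite expr2; apply: ler_wpM2l => //; apply: le_trans sad.
  by rewrite (bigD1 a) //= lerDl sumr_ge0.
rewrite -[_ / e]invrK invf_div lef_pV2 ?posrE ?smooth_cond_ge // ?smooth_cond_gt0 //.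
by rewrite divr_gt0.
Qed.

(** Markov's inequality for the ratio P / Q, whose mean under P is the sum of P^2 / Q and factorises
    letter by letter. *)
Lemma likelihood_smooth_test (n : nat) (s : R) :
  \sum_(u : k0.-tuple A) \sum_(v : n.-tuple A |
     expR s * lik Q u v <= lik c u v) p (u ++ v) <=
    expR (- s) * (1 + 16 * #|A|%:R * e) ^+ n.
Proof.
pose r u a := c u a ^+ 2 / Q u a.
have r0 u a : 0 <= r u a by rewrite divr_ge0 ?sqr_ge0 // ltW ?smooth_cond_gt0.
have bnd0 : 0 <= 1 + 16 * #|A|%:R * e by rewrite addr_ge0 // !mulr_ge0 // ltW.
have hn (u : k0.-tuple A) : \sum_(v : n.-tuple A) lik r u v <= (1 + 16 * #|A|%:R * e) ^+ n.
  have -> : \sum_(v : n.-tuple A) lik r u v = iter (n * 1) (step r) (fun=> 1) u.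
    by rewrite muln1 iter_step; apply: eq_bigr => v _; rewrite mulr1.
  apply: (@iter_step_block _ _ r k0) => //; rewrite ?size_tuple // => v kv.
  rewrite /= /step; under eq_bigr do rewrite mulr1; exact: smooth_chi2.
apply: (@le_trans _ _ (\sum_(u : k0.-tuple A) p u * (expR (- s) * (1 + 16 * #|A|%:R * e) ^+ n))); last first.
  by rewrite -mulr_suml sum_law mul1r.
apply: ler_sum => u _; under eq_bigr do rewrite law_lik.
rewrite -mulr_sumr; apply: ler_wpM2l => //.
apply: (@le_trans _ _ (expR (- s) * \sum_(v : n.-tuple A) lik r u v)); last first.
  by apply: ler_wpM2l; [apply: expR_ge0|apply: hn].
rewrite mulr_sumr [leRHS](bigID (fun v : n.-tuple A => expR s * lik Q u v <= lik c u v)) /=.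
rewrite -[leLHS]addr0; apply: lerD; last first.
  by apply: sumr_ge0 => v _; rewrite mulr_ge0 ?expR_ge0 // lik_ge0.
apply: ler_sum => v hv; rewrite lik_div.
have Q0 : 0 < lik Q u v by apply: lik_gt0 => w a; apply: smooth_cond_gt0.
have C0 : 0 <= lik c u v by apply/lik_ge0/cond_ge0.
rewrite expRN ler_pdivlMl ?expR_gt0 // ler_pdivlMr // expr2 mulrAC.
exact: ler_wpM2r.
Qed.

End SmoothedMarkov.

End Process.

(** * Counts and maximum likelihood *)

Section Counts.
Variable A : finType.
Implicit Types s u v w : seq A.

Lemma occE u s :
  occ u s = (\sum_(0 <= i < (size s).+1 - size u) (take (size u) (drop i s) == u))%N.
Proof.
rewrite (big_nat_widen _ _ _ _ _ (leq_subr (size u) (size s).+1)) big_mkord.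
by apply: eq_bigl => i; rewrite ltn_subRL ltnS addnC.
Qed.

Lemma occ_eq0 u s : (size s < size u)%N -> occ u s = 0%N.
Proof. by move=> su; rewrite occE big_geq // leqn0 subn_eq0. Qed.

Lemma occ_le u s : (0 < size u)%N -> (occ u s <= size s)%N.
Proof.
move=> u0; rewrite occE; apply: (@leq_trans ((size s).+1 - size u)); last first.
  by rewrite leq_subLR -add1n leq_add2r.
apply: leq_trans (_ : (\sum_(0 <= i < (size s).+1 - size u) 1 <= _)%N).
  by apply: leq_sum => i _; apply: leq_b1.
by rewrite sum_nat_const_nat muln1 subn0.
Qed.

Lemma occ_rcons u s a : (0 < size u)%N -> (size u <= (size s).+1)%N ->
  occ u (rcons s a) = (occ u s + (lastn (size u) (rcons s a) == u))%N.
Proof.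
move=> u0 us; rewrite !occE size_rcons subSn // big_nat_recr //=; congr addn.
  rewrite !big_nat; apply: eq_bigr => i /andP[_ hi].
  have his : (i + size u <= size s)%N by rewrite -ltnS addnC -ltn_subRL.
  rewrite drop_rcons; last by apply: leq_trans his; apply: leq_addr.
  by rewrite -cats1 takel_cat // size_drop leq_subRL ?(leq_trans (leq_addr _ _) his).
by rewrite /lastn size_rcons take_oversize // size_drop size_rcons subKn.
Qed.

(** An occurrence that stops before the last letter is continued by exactly one letter. For empty
    [w] both sides are [size s], the convention for order 0; an empty [s] would break it. *)
Lemma Nn1E s w : (0 < size s)%N -> Nn1 s w = (\sum_a Nn s (rcons w a))%N.
Proof.
case/lastP: s => // s b _; rewrite /Nn1 /Nn size_rcons -{1}cats1 take_size_cat //.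
under eq_bigr do rewrite occE !size_rcons subSS.
rewrite occE exchange_big /= !big_nat; apply: eq_bigr => i /andP[_].
rewrite ltn_subRL ltnS addnC => hi.
have his : (i <= size s)%N by apply: leq_trans (leq_addr _ _) hi.
set y := take _ (drop i (rcons s b)).
have sy : size y = (size w).+1.
  by rewrite size_takel // size_drop size_rcons subSn // ltnS leq_subRL.
have -> : take (size w) (drop i s) = take (size w) y.
  rewrite /y take_takel // drop_rcons // -cats1 takel_cat //.
  by rewrite size_drop leq_subRL.
case/lastP: y sy => // y e; rewrite size_rcons => -[sy].
under eq_bigr do rewrite eqseq_rcons.
rewrite -sy -cats1 take_size_cat // (bigD1 e) //= eqxx andbT big1 ?addn0 // => a ae.
by rewrite [e == a]eq_sym (negbTE ae) andbF.
Qed.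

Lemma lastn_rcons k u a : lastn k.+1 (rcons u a) = rcons (lastn k u) a.
Proof. by rewrite /lastn size_rcons subSS drop_rcons // leq_subr. Qed.

Variable R : realType.

(** Transition counts are a sufficient statistic for kernels of memory [k]. The prefix [u] has
    exactly [k] letters, so it contains no transition of its own. *)
Lemma lik_occ (r : seq A -> A -> R) (k : nat) u v :
  (forall x w a, (k <= size w)%N -> r (x ++ w) a = r w a) -> size u = k ->
  lik r u v = \prod_(w : k.-tuple A) \prod_a r w a ^+ Nn (u ++ v) (rcons w a).
Proof.
move=> rdep su; elim/last_ind: v => [|v b IH].
  rewrite cats0 big1 // => w _; rewrite big1 // => a _.
  by rewrite /Nn occ_eq0 ?expr0 // size_rcons size_tuple su.
have kuv : (k <= size (u ++ v))%N by rewrite size_cat su leq_addr.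
rewrite lik_rcons IH -rcons_cat.
under [RHS]eq_bigr => w _ do under eq_bigr => a _ do
  rewrite /Nn occ_rcons ?size_rcons ?size_tuple ?ltnS // exprD.
under [RHS]eq_bigr => w _ do rewrite big_split.
rewrite big_split /=; congr (_ * _).
have sw : size (lastn k (u ++ v)) == k by rewrite size_lastn.
rewrite (bigD1 (Tuple sw)) //= [X in _ * X]big1 ?mulr1; last first.
  move=> w wn; rewrite big1 // => a _.
  rewrite lastn_rcons eqseq_rcons; case: eqP => [e|]; last by rewrite expr0.
  by case/eqP: wn; apply: val_inj.
rewrite (bigD1 b) //= lastn_rcons eqxx expr1 big1 ?mulr1.
  by rewrite -{1}(lastnK k (u ++ v)) rdep // size_lastn.
by move=> a ab; rewrite eqseq_rcons eqxx eq_sym (negbTE ab) expr0.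
Qed.

Lemma MLE k s : (0 < size s)%N ->
  ML R k s = \prod_(w : k.-tuple A) \prod_a
    ((Nn s (rcons w a))%:R / (\sum_b Nn s (rcons w b))%:R) ^+ Nn s (rcons w a).
Proof.
move=> s0; rewrite /ML (big_tuple_rcons _ _ (fun t =>
  ((Nn s t)%:R / (Nn1 s (take k t))%:R : R) ^+ Nn s t)).
apply: eq_bigr => w _; apply: eq_bigr => a _.
by rewrite -cats1 take_cat size_tuple ltnn subnn take0 cats0 cats1 Nn1E.
Qed.

Lemma ML_gt0 k s : (0 < size s)%N -> 0 < ML R k s.
Proof.
move=> s0; rewrite MLE //; apply: prodr_gt0 => w _; apply: prodr_gt0 => a _.
have [->|n0] := posnP (Nn s (rcons w a)); first by rewrite expr0.
by rewrite exprn_gt0 // divr_gt0 ?ltr0n // (bigD1 a) //= addn_gt0 n0.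
Qed.

(** Apply x <= exp (x - 1) to x = Q_i S / N_i, where S is the total count: the exponents add up to S
    (sum Q - 1) <= 0. No logarithm is taken, so zero weights and zero counts are harmless. *)
Lemma gibbs (I : finType) (N : I -> nat) (Q : I -> R) :
  (forall i, 0 <= Q i) -> \sum_i Q i <= 1 ->
  \prod_i Q i ^+ N i <= \prod_i ((N i)%:R / (\sum_j N j)%:R) ^+ N i.
Proof.
move=> Q0 Q1; set S := (\sum_j N j)%N.
apply: (@le_trans _ _ (\prod_i (((N i)%:R / S%:R) ^+ N i * expR (S%:R * Q i - (N i)%:R)))).
  apply: ler_prod => i _; rewrite exprn_ge0 //=.
  have [Ni0|Ni] := posnP (N i).
    by rewrite Ni0 !expr0 mul1r subr0 -[leLHS]expR0 ler_expR mulr_ge0.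
  have S0 : (0 < S)%N by rewrite /S (bigD1 i) //= addn_gt0 Ni.
  have N0R : 0 < (N i)%:R :> R by rewrite ltr0n.
  have S0R : 0 < S%:R :> R by rewrite ltr0n.
  have -> : S%:R * Q i - (N i)%:R = (N i)%:R * (Q i / ((N i)%:R / S%:R) - 1).
    by field; rewrite !gt_eqF.
  rewrite expRM_natl -exprMn; apply: lerXn2r; rewrite ?nnegrE ?mulr_ge0 ?divr_ge0 ?expR_ge0 //.
  rewrite -ler_pdivrMl ?divr_gt0 // mulrC.
  by have := expR_ge1Dx (Q i / ((N i)%:R / S%:R) - 1); rewrite subrKC.
rewrite big_split /=; rewrite -[leRHS]mulr1; apply: ler_wpM2l.
  by apply: prodr_ge0 => i _; rewrite exprn_ge0 // divr_ge0.
rewrite -expR_sum -[leRHS]expR0 ler_expR sumrB -mulr_sumr -natr_sum -/S subr_le0.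
by rewrite -[leRHS]mulr1; apply: ler_wpM2l.
Qed.

Lemma lik_le_ML (r : seq A -> A -> R) (k : nat) s :
  (forall x w a, (k <= size w)%N -> r (x ++ w) a = r w a) ->
  (forall u a, 0 <= r u a) -> (forall u, \sum_a r u a <= 1) -> (k < size s)%N ->
  lik r (take k s) (drop k s) <= ML R k s.
Proof.
move=> rdep r0 r1 ks; rewrite (lik_occ (k := k)) // ?size_takel 1?ltnW //.
rewrite cat_take_drop MLE ?(leq_ltn_trans _ ks) //.
apply: ler_prod => w _; rewrite gibbs // andbT.
by apply: prodr_ge0 => a _; apply: exprn_ge0.
Qed.

(* Every maximum likelihood is attained by one of these kernels, and there are
   only (n+1)^(|A|^(k+1)) of them: this is the union bound over the k-step
   Markov alternatives. *)
Definition count_of (n k : nat) (N : {ffun k.-tuple A -> 'I_n}) (t : seq A) : nat :=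
  if insub t is Some t' then N t' else 0%N.

Definition count_kernel (n k : nat) (N : {ffun k.+1.-tuple A -> 'I_n}) u (a : A) : R :=
  (count_of N (rcons (lastn k u) a))%:R / (\sum_b count_of N (rcons (lastn k u) b))%:R.

Lemma count_kernel_dep n k (N : {ffun k.+1.-tuple A -> 'I_n}) x w a :
  (k <= size w)%N -> count_kernel N (x ++ w) a = count_kernel N w a.
Proof. by move=> kw; rewrite /count_kernel lastn_cat. Qed.

Lemma count_kernel_ge0 n k (N : {ffun k.+1.-tuple A -> 'I_n}) u a : 0 <= count_kernel N u a.
Proof. exact: divr_ge0. Qed.

Lemma sum_count_kernel_le1 n k (N : {ffun k.+1.-tuple A -> 'I_n}) u :
  \sum_a count_kernel N u a <= 1.
Proof.
rewrite -mulr_suml -natr_sum; set S := (\sum_b _)%N.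
by have [->|S0] := posnP S; rewrite ?mul0r // divff // pnatr_eq0 -lt0n.
Qed.

Lemma count_kernel_le1 n k (N : {ffun k.+1.-tuple A -> 'I_n}) u a : 0 <= count_kernel N u a <= 1.
Proof.
rewrite count_kernel_ge0; apply: le_trans (sum_count_kernel_le1 N u).
by rewrite (bigD1 a) //= lerDl sumr_ge0 // => b _; apply: count_kernel_ge0.
Qed.

Lemma ML_count_kernel k s : (k < size s)%N ->
  exists N : {ffun k.+1.-tuple A -> 'I_(size s).+1},
    ML R k s = lik (count_kernel N) (take k s) (drop k s).
Proof.
move=> ks; exists [ffun t : k.+1.-tuple A => inord (Nn s t)].
rewrite (lik_occ (k := k)) ?size_takel 1?ltnW //; last exact: count_kernel_dep.
rewrite cat_take_drop MLE ?(leq_ltn_trans _ ks) //.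
apply: eq_bigr => w _; apply: eq_bigr => a _; rewrite /count_kernel.
have cE b : count_of [ffun t : k.+1.-tuple A => (inord (Nn s t) : 'I_(size s).+1)]
    (rcons (lastn k w) b) = Nn s (rcons w b).
  have -> : lastn k w = w by have := lastn_id w; rewrite size_tuple.
  rewrite /count_of.
  have e : size (rcons w b) == k.+1 by rewrite size_rcons size_tuple.
  rewrite (insubT (fun t => size t == k.+1) e) ffunE inordK //= ltnS.
  by apply: occ_le; rewrite size_rcons.
by rewrite cE; under [in RHS]eq_bigr do rewrite cE.
Qed.

(** The factors of the letters between positions [k] and [k0] are at most 1 and are dropped, so that
    all orders are compared on the letters after the first [k0]. *)
Lemma ML_le_count_kernel k k0 s : (k <= k0)%N -> (k0 < size s)%N ->
  exists N : {ffun k.+1.-tuple A -> 'I_(size s).+1},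
    ML R k s <= lik (count_kernel N) (take k0 s) (drop k0 s).
Proof.
move=> kk0 k0s; have [N ->] := ML_count_kernel (leq_ltn_trans kk0 k0s).
exists N; set r := count_kernel N.
have -> : drop k s = take (k0 - k) (drop k s) ++ drop k0 s.
  have -> : drop k0 s = drop (k0 - k) (drop k s) by rewrite drop_drop subnK.
  by rewrite cat_take_drop.
have -> : take k0 s = take k s ++ take (k0 - k) (drop k s).
  by rewrite -takeD subnKC.
rewrite lik_cat -[leRHS]mul1r; apply: ler_wpM2r; first exact/lik_ge0/count_kernel_ge0.
exact/lik_le1/count_kernel_le1.
Qed.

(** The maximum over count kernels is replaced by their sum; each kernel has mass at most 1 for each
    of the |A|^k initial words. *)
Lemma sum_ML_le k n : (k < n)%N ->
  \sum_(y : n.-tuple A) ML R k y <= ((n.+1 ^ (#|A| ^ k.+1)) * #|A| ^ k)%:R.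
Proof.
move=> kn.
have h (y : n.-tuple A) : ML R k y <=
    \sum_(N : {ffun k.+1.-tuple A -> 'I_n.+1}) lik (count_kernel N) (take k y) (drop k y).
  have := @ML_count_kernel k y; rewrite size_tuple => /(_ kn)[N ->].
  rewrite (bigD1 N) //= lerDl; apply: sumr_ge0 => N' _; exact/lik_ge0/count_kernel_ge0.
apply: le_trans (ler_sum _ (fun y _ => h y)) _; rewrite exchange_big /=.
rewrite natrM.
have -> : (n.+1 ^ (#|A| ^ k.+1))%:R = \sum_(N : {ffun k.+1.-tuple A -> 'I_n.+1}) (1 : R).
  by rewrite sumr_const card_ffun card_tuple card_ord.
rewrite mulr_suml; apply: ler_sum => N _; rewrite mul1r.
pose F (y : seq A) := lik (count_kernel N) (take k y) (drop k y).
rewrite (big_tuple_split _ F (ltnW kn)).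
have -> : (#|A| ^ k)%:R = \sum_(u : k.-tuple A) (1 : R) by rewrite sumr_const card_tuple.
apply: ler_sum => u _; apply: le_trans (@sum_lik_le1 _ _ (n - k) _ u (@count_kernel_ge0 _ _ N) (@sum_count_kernel_le1 _ _ N)).
by apply: ler_sum => v _; rewrite /F take_cat drop_cat size_tuple ltnn subnn take0 drop0 cats0.
Qed.

(** A constant word has likelihood 1 under the kernel that always emits its letter. This lets the
    NML normaliser of the smaller order be discarded. *)
Lemma sum_ML_ge1 k n : (0 < #|A|)%N -> (k < n)%N -> 1 <= \sum_(y : n.-tuple A) ML R k y.
Proof.
move=> /card_gt0P[a0 _] kn; have n0 : (0 < n)%N by apply: leq_ltn_trans kn.
rewrite (bigD1 [tuple of nseq n a0]) //= -[leLHS]addr0; apply: lerD; last first.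
  by apply: sumr_ge0 => y _; apply/ltW/ML_gt0; rewrite size_tuple.
pose r (u : seq A) a : R := (a == a0)%:R.
have r1 u v : all (pred1 a0) v -> lik r u v = 1.
  by elim: v u => //= a v IH u /andP[/eqP-> av]; rewrite /r eqxx mul1r; apply: IH.
rewrite -(r1 (take k (nseq n a0)) (drop k (nseq n a0))).
  apply: lik_le_ML => //; rewrite ?size_nseq // => u.
  by rewrite (bigD1 a0) //= /r eqxx big1 ?addr0 // => a /negbTE->.
by rewrite drop_nseq all_nseq /= eqxx orbT.
Qed.

End Counts.

(** * Factorials and rising products up to polynomial factors *)

Section Factorials.
Variable R : realType.

(** Stirling's formula without its square-root factor: polynomial errors are affordable, and in this
    form products of empirical frequencies become exact ratios. *)
Definition stirling (m : nat) : R := m%:R ^+ m * expR (- m%:R).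

Lemma stirling_ge0 m : 0 <= stirling m. Proof. by rewrite mulr_ge0 ?exprn_ge0 ?expR_ge0. Qed.

Lemma stirling_gt0 m : 0 < stirling m.
Proof.
by case: m => [|m]; rewrite mulr_gt0 ?expR_gt0 // ?expr0 // exprn_gt0 // ltr0n.
Qed.

Lemma fact_ge_stirling m : stirling m <= m`!%:R.
Proof.
elim: m => [|m IH]; first by rewrite /stirling expr0 oppr0 expR0 mulr1.
rewrite factS natrM /stirling exprS -mulrA; apply: ler_wpM2l => //.
apply: le_trans IH; rewrite /stirling.
have -> : expR (- m%:R) = expR 1 * expR (- m.+1%:R) :> R.
  by rewrite -expRD; congr expR; rewrite -natr1; ring.
rewrite mulrA; apply: ler_wpM2r; first exact: expR_ge0.
case: m => [|m]; first by rewrite !expr0 mul1r -[leLHS]expR0 ler_expR.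
have m0 : m.+1%:R != 0 :> R by rewrite pnatr_eq0.
have base : m.+2%:R <= m.+1%:R * expR (m.+1%:R^-1) :> R.
  have := ler_wpM2l (ler0n R m.+1) (expR_ge1Dx (m.+1%:R^-1)).
  by rewrite mulrDr mulr1 divff // natr1.
apply: (@le_trans _ _ ((m.+1%:R * expR (m.+1%:R^-1)) ^+ m.+1)).
  by apply: lerXn2r; rewrite ?nnegrE ?mulr_ge0 ?expR_ge0.
by rewrite exprMn -expRM_natl divff.
Qed.

Lemma fact_le_stirling m n : (m <= n)%N -> (0 < n)%N -> m`!%:R <= expR 1 * n%:R * stirling m.
Proof.
case: m => [_ n0|m mn _].
  rewrite /stirling expr0 oppr0 expR0 !mulr1 fact0 -[leLHS]mulr1; apply: ler_pM => //.
    by rewrite -[leLHS]expR0 ler_expR.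
  by rewrite ler1n.
apply: (@le_trans _ _ (expR 1 * m.+1%:R * stirling m.+1)); last first.
  apply: ler_wpM2r; first exact: stirling_ge0.
  by apply: ler_wpM2l; rewrite ?expR_ge0 ?ler_nat.
elim: m {n mn} => [|m IH].
  by rewrite /stirling expr1 mul1r mulr1 -expRD subrr expR0.
rewrite factS natrM.
apply: (le_trans (ler_wpM2l (ler0n R _) IH)).
have base : m.+1%:R <= m.+2%:R * expR (- m.+2%:R^-1) :> R.
  have := ler_wpM2l (ler0n R m.+2) (expR_ge1Dx (- m.+2%:R^-1)).
  by rewrite mulrDr mulr1 mulrN divff ?pnatr_eq0 // -[in X in X - 1]natr1 addrK.
have pw : m.+1%:R ^+ m.+2 <= m.+2%:R ^+ m.+2 * expR (- 1) :> R.
  apply: (@le_trans _ _ ((m.+2%:R * expR (- m.+2%:R^-1)) ^+ m.+2)).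
    by apply: lerXn2r; rewrite ?nnegrE ?mulr_ge0 ?expR_ge0.
  by rewrite exprMn -expRM_natl mulrN divff ?pnatr_eq0.
have -> : m.+2%:R * (expR 1 * m.+1%:R * stirling m.+1) =
    m.+2%:R * expR 1 * expR (- m.+1%:R) * m.+1%:R ^+ m.+2 :> R.
  by rewrite /stirling [_ ^+ m.+2]exprS; move: (_ ^+ m.+1) => X; ring.
have -> : expR 1 * m.+2%:R * stirling m.+2 =
    m.+2%:R * expR 1 * expR (- m.+1%:R) * (m.+2%:R ^+ m.+2 * expR (- 1)) :> R.
  have -> : stirling m.+2 = m.+2%:R ^+ m.+2 * (expR (- m.+1%:R) * expR (- 1)).
    by rewrite /stirling -expRD -opprD natr1.
  by move: (m.+2%:R ^+ m.+2) => X; ring.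
by apply: ler_wpM2l; rewrite ?mulr_ge0 ?expR_ge0.
Qed.

Lemma prod_half_le m : \prod_(j < m) (j%:R + 2^-1 : R) <= m`!%:R.
Proof.
elim: m => [|m IH]; first by rewrite big_ord0.
rewrite big_ord_recr factS natrM mulrC /=; apply: ler_pM => //.
- by apply: prodr_ge0 => j _; rewrite addr_ge0 // invr_ge0.
- by rewrite -[m.+1%:R]natr1; lra.
Qed.

Lemma prod_half_ge m n : (m <= n)%N -> (0 < n)%N ->
  m`!%:R <= 2 * n%:R * \prod_(j < m) (j%:R + 2^-1 : R).
Proof.
move=> mn n0; case: m mn => [_|m mn].
  rewrite big_ord0 mulr1 fact0; apply: (@le_trans _ _ n%:R); first by rewrite ler1n.
  by have : 0 <= n%:R :> R by []; lra.
have P0 k : 0 <= \prod_(j < k) (j%:R + 2^-1 : R).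
  by apply: prodr_ge0 => j _; rewrite addr_ge0 // invr_ge0.
apply: (@le_trans _ _ (2 * m.+1%:R * \prod_(j < m.+1) (j%:R + 2^-1 : R))); last first.
  by apply: ler_wpM2r => //; apply: ler_wpM2l; rewrite ?ler_nat.
elim: m {mn} => [|m IH]; first by rewrite big_ord1 add0r mulr1 divff.
rewrite factS natrM; apply: (le_trans (ler_wpM2l (ler0n R _) IH)).
rewrite [in leRHS]big_ord_recr /=.
have := P0 m.+1; move: (\prod_(j < m.+1) _) => X X0.
have -> : m.+2%:R * (2 * m.+1%:R * X) = 2 * m.+2%:R * X * m.+1%:R by ring.
rewrite [leRHS]mulrA; apply: ler_wpM2l; last by rewrite lerDl invr_ge0.
by rewrite !mulr_ge0.
Qed.

Lemma prod_shift_ge m (b : R) : 1 <= b -> m`!%:R <= \prod_(j < m) (j%:R + b).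
Proof.
move=> b1; elim: m => [|m IH]; first by rewrite big_ord0.
rewrite big_ord_recr factS natrM mulrC /=; apply: ler_pM => //.
by rewrite -natr1 lerD2l.
Qed.

(** In the induction, Bernoulli's inequality lets the growth of [m.+1%:R ^+ B] absorb the quotient
    (m + b) / (m + 1). *)
Lemma prod_shift_le m (B : nat) (b : R) : 0 <= b -> b <= B%:R ->
  \prod_(j < m) (j%:R + b) <= m`!%:R * m.+1%:R ^+ B.
Proof.
move=> b0 bB; elim: m => [|m IH]; first by rewrite big_ord0 expr1n mulr1.
have P0 k : 0 <= \prod_(j < k) (j%:R + b).
  by apply: prodr_ge0 => j _; rewrite addr_ge0.
rewrite big_ord_recr /=; apply: (@le_trans _ _ (m`!%:R * m.+1%:R ^+ B * (m%:R + b))).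
  by apply: ler_wpM2r; rewrite ?addr_ge0.
rewrite factS natrM -mulrA [X in _ <= X * _]mulrC -mulrA; apply: ler_wpM2l => //.
have m0 : m.+1%:R != 0 :> R by rewrite pnatr_eq0.
have bern k : 1 + k%:R * m.+1%:R^-1 <= (1 + m.+1%:R^-1 : R) ^+ k.
  elim: k => [|k IHk]; first by rewrite mul0r addr0 expr0.
  have x0 : 0 <= m.+1%:R^-1 :> R by rewrite invr_ge0.
  rewrite exprS; apply: (@le_trans _ _ ((1 + m.+1%:R^-1) * (1 + k%:R * m.+1%:R^-1))).
    rewrite -[k.+1%:R]natr1; have : 0 <= k%:R :> R by [].
    move: x0; move: (m.+1%:R^-1) (k%:R) => x y x0 y0.
    rewrite -subr_ge0.
    have -> : (1 + x) * (1 + y * x) - (1 + (y + 1) * x) = y * x ^+ 2 by ring.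
    by rewrite mulr_ge0 ?sqr_ge0.
  by apply: ler_wpM2l => //; rewrite addr_ge0.
have E : m.+2%:R = m.+1%:R * (1 + m.+1%:R^-1) :> R by rewrite mulrDr mulr1 divff // natr1.
rewrite E exprMn [leRHS]mulrCA; apply: ler_wpM2l; first exact: exprn_ge0.
apply: (@le_trans _ _ (m.+1%:R * (1 + B%:R * m.+1%:R^-1))); last exact: ler_wpM2l.
rewrite mulrDr mulr1 mulrCA divff // mulr1 -[m.+1%:R]natr1.
by move: bB; lra.
Qed.

End Factorials.

(** * The three criteria against the maximum likelihood *)

Section CriterionComparison.
Variables (R : realType) (A : finType).
Hypothesis A_ge2 : (2 <= #|A|)%N.

Lemma freq_stirling (N : A -> nat) : (0 < \sum_a N a)%N ->
  \prod_a ((N a)%:R / (\sum_b N b)%:R) ^+ N a =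
  (\prod_a stirling R (N a)) / stirling R (\sum_b N b).
Proof.
set S := (\sum_b N b)%N => S0.
rewrite /stirling big_split /= -expR_sum.
have -> : \sum_a - (N a)%:R = - S%:R :> R by rewrite sumrN -natr_sum.
rewrite invfM mulrACA divff ?mulr1 ?gt_eqF ?expR_gt0 //.
under eq_bigr do rewrite expr_div_n.
rewrite prodf_div; congr (_ / _).
by rewrite /S expr_sum.
Qed.

(** The numerator costs (e n)^B or (2 n)^B, at most n^(2B) as e <= n, and the denominator n^(2 +
    2B); since B = |A| >= 2 the total 4B + 2 is at most 5B. *)
Lemma KT_context_bounds (N : A -> nat) (n : nat) :
  (0 < \sum_a N a)%N -> (\sum_a N a <= n)%N -> expR 1 <= n%:R :> R ->
  let kt := (\prod_(a : A | (1 <= N a)%N) \prod_(j < N a) (j%:R + 2^-1)) /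
     (\prod_(j < \sum_a N a) (j%:R + #|A|%:R / 2)) in
  let ml := \prod_a ((N a)%:R / (\sum_b N b)%:R) ^+ N a in
  [/\ 0 < kt, kt <= n%:R ^+ (5 * #|A|) * ml & ml <= n%:R ^+ (5 * #|A|) * kt :> R].
Proof.
set S := (\sum_b N b)%N => S0 Sn en /=; rewrite freq_stirling // -/S.
have n0 : (0 < n)%N by apply: leq_trans Sn.
have n1 : 1 <= n%:R :> R by rewrite ler1n.
have n2 : 2 <= n%:R :> R.
  by have := le_trans (expR_ge1Dx 1) en; rewrite [1 + 1](_ : _ = 2) //; ring.
have NS a : (N a <= n)%N by apply: leq_trans Sn; rewrite /S (bigD1 a) //= leq_addr.
set B := #|A|; have B0 : (0 < B)%N by apply: leq_trans A_ge2.
rewrite big_mkcond /=.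
have -> : \prod_a (if (1 <= N a)%N then \prod_(j < N a) (j%:R + 2^-1) else 1) =
    \prod_a \prod_(j < N a) (j%:R + 2^-1) :> R.
  by apply: eq_bigr => a _; case: posnP => // ->; rewrite big_ord0.
set num := \prod_a _; set den := \prod_(j < S) _.
have b1 : 1 <= B%:R / 2 :> R by rewrite ler_pdivlMr // mul1r ler_nat.
have den_ge : S`!%:R <= den by apply: prod_shift_ge.
have den_le : den <= S`!%:R * S.+1%:R ^+ B.
  apply: prod_shift_le; first exact: le_trans b1.
  by have : 0 <= B%:R :> R by []; lra.
have S_fact : 0 < S`!%:R :> R by rewrite ltr0n fact_gt0.
have den0 : 0 < den by apply: lt_le_trans den_ge.
have P0 m : 0 < \prod_(j < m) (j%:R + 2^-1) :> R.
  by apply: prodr_gt0 => j _; rewrite ltr_wpDl // invr_gt0.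
have num0 : 0 < num by apply: prodr_gt0.
have num_le : num <= (expR 1 * n%:R) ^+ B * \prod_a stirling R (N a).
  rewrite /B -prodr_const -big_split /=; apply: ler_prod => a _.
  apply/andP; split; first exact: ltW.
  by apply: le_trans (prod_half_le _ _) _; apply: fact_le_stirling.
have num_ge : \prod_a stirling R (N a) <= (2 * n%:R) ^+ B * num.
  rewrite /B -prodr_const -big_split /=; apply: ler_prod => a _.
  by rewrite stirling_ge0 /=; apply: le_trans (fact_ge_stirling _ _) _; apply: prod_half_ge.
have st0 : 0 < stirling R S by apply: stirling_gt0.
have pst0 : 0 < \prod_a stirling R (N a) by apply: prodr_gt0 => a _; apply: stirling_gt0.
have den_le' : den <= n%:R ^+ (2 + 2 * B) * stirling R S.
  apply: (le_trans den_le).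
  have -> : n%:R ^+ (2 + 2 * B) * stirling R S = (n%:R * n%:R * stirling R S) * (n%:R * n%:R) ^+ B.
    by rewrite exprD exprM !expr2; ring.
  apply: ler_pM; rewrite ?exprn_ge0 //.
    apply: le_trans (fact_le_stirling _ Sn n0) _.
    apply: ler_wpM2r; first exact: ltW.
    exact: ler_wpM2r.
  apply: lerXn2r; rewrite ?nnegrE ?mulr_ge0 //.
  rewrite -natrM ler_nat; apply: leq_ltn_trans Sn _.
  by rewrite -{1}[n]muln1 ltn_pmul2l // -(ltr_nat R); apply: lt_le_trans n2; rewrite ltr1n.
have pw m : (m <= 5 * B)%N -> n%:R ^+ m <= n%:R ^+ (5 * B) :> R by move=> h; apply: ler_weXn2l.
split; first exact: divr_gt0.
  rewrite ler_pdivrMr //; apply: le_trans num_le _.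
  have -> : n%:R ^+ (5 * B) * (\prod_a stirling R (N a) / stirling R S) * den =
    (n%:R ^+ (5 * B) * \prod_a stirling R (N a)) * (den / stirling R S) by ring.
  rewrite -[leLHS]mulr1; apply: ler_pM => //.
  - by rewrite mulr_ge0 ?exprn_ge0 ?mulr_ge0 ?expR_ge0 // ltW.
  - apply: ler_wpM2r; first exact: ltW.
    apply: le_trans (pw (2 * B)%N _); last by rewrite leq_pmul2r.
    rewrite exprM expr2; apply: lerXn2r; rewrite ?nnegrE ?mulr_ge0 ?expR_ge0 //.
    by apply: ler_wpM2r.
  by rewrite ler_pdivlMr // mul1r; apply: le_trans den_ge; apply: fact_ge_stirling.
rewrite ler_pdivrMr //; apply: le_trans num_ge _.
have -> : n%:R ^+ (5 * B) * (num / den) * stirling R S =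
   (n%:R ^+ (5 * B) * stirling R S / den) * num by ring.
apply: ler_wpM2r; first exact: ltW.
rewrite ler_pdivlMr //; apply: (@le_trans _ _ (n%:R ^+ (2 * B) * (n%:R ^+ (2 + 2 * B) * stirling R S))).
  apply: ler_pM => //; first exact: ltW.
  rewrite exprM expr2; apply: lerXn2r; rewrite ?nnegrE ?mulr_ge0 //.
  exact: ler_wpM2r.
rewrite mulrA -exprD; apply: ler_wpM2r; first exact: ltW.
by apply: pw; rewrite addnCA -mulnDl (leq_trans (_ : _ <= B + (2 + 2) * B)%N) // leq_add2r.
Qed.

Lemma P_KT_bounds k (s : seq A) : (0 < size s)%N -> expR 1 <= (size s)%:R :> R ->
  let L := (size s)%:R ^+ (5 * #|A| * #|A| ^ k) in
  [/\ 0 < P_KT R k s, P_KT R k s <= L * ML R k s & ML R k s <= (#|A| ^ k)%:R * L * P_KT R k s].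
Proof.
move=> s0 es L; set n := size s in s0 es L *.
pose kt (w : k.-tuple A) : R := (\prod_(a : A | (1 <= Nn s (rcons w a))%N)
        \prod_(j < Nn s (rcons w a)) (j%:R + 2^-1)) /
     (\prod_(j < Nn1 s w) (j%:R + #|A|%:R / 2)).
pose ml (w : k.-tuple A) : R := \prod_a
    ((Nn s (rcons w a))%:R / (\sum_b Nn s (rcons w b))%:R) ^+ Nn s (rcons w a).
have Bk0 : 0 < (#|A| ^ k)%:R :> R by rewrite ltr0n expn_gt0 (leq_trans _ A_ge2).
have PE : P_KT R k s = (#|A| ^ k)%:R^-1 * \prod_(w : k.-tuple A | (1 <= Nn1 s w)%N) kt w.
  by rewrite /P_KT natrX.
have ME : ML R k s = \prod_(w : k.-tuple A | (1 <= Nn1 s w)%N) ml w.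
  rewrite MLE // [RHS]big_mkcond; apply: eq_bigr => w _.
  case: posnP => //; rewrite Nn1E // => /eqP; rewrite sum_nat_eq0 => /forallP h.
  by rewrite big1 // => a _; rewrite (eqP (h a)) expr0.
have Nn1_le (w : k.-tuple A) : (Nn1 s w <= n)%N.
  rewrite /Nn1 occE; apply: leq_trans (_ : (\sum_(0 <= i < (size (take (size s).-1 s)).+1 - size w) 1 <= _)%N).
    by apply: leq_sum => i _; apply: leq_b1.
  rewrite sum_nat_const_nat muln1 subn0 size_takel ?leq_pred // prednK //.
  exact: leq_subr.
have bnd (w : k.-tuple A) : (1 <= Nn1 s w)%N -> [/\ 0 < kt w,
    kt w <= n%:R ^+ (5 * #|A|) * ml w & ml w <= n%:R ^+ (5 * #|A|) * kt w].
  rewrite /kt /ml => w0.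
  have := Nn1_le w; move: w0; rewrite !Nn1E // => w0 wn.
  exact: (KT_context_bounds w0 wn es).
have L_ge1 : 1 <= n%:R ^+ (5 * #|A|) :> R by apply: exprn_ege1; rewrite ler1n.
have cst (F : k.-tuple A -> R) : (forall w : k.-tuple A, (1 <= Nn1 s w)%N -> 0 <= F w) ->
    \prod_(w : k.-tuple A | (1 <= Nn1 s w)%N) (n%:R ^+ (5 * #|A|) * F w) <=
    L * \prod_(w : k.-tuple A | (1 <= Nn1 s w)%N) F w.
  move=> F0; rewrite big_split /=; apply: ler_wpM2r; first exact: prodr_ge0.
  rewrite prodr_const /L -exprM; apply: ler_weXn2l; first by rewrite ler1n.
  by rewrite leq_mul2l -[(#|A| ^ k)%N](card_tuple k A) max_card orbT.
have kt0 : 0 < \prod_(w : k.-tuple A | (1 <= Nn1 s w)%N) kt w.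
  by apply: prodr_gt0 => w /bnd[].
split; first by rewrite PE mulr_gt0 ?invr_gt0.
  rewrite PE ler_pdivrMl //; apply: (@le_trans _ _ (L * ML R k s)).
    rewrite ME; apply: le_trans (cst _ _).
      by apply: ler_prod => w /bnd[h1 h2 _]; rewrite ltW.
    by move=> w /bnd[h1 h2 _]; have := lt_le_trans h1 h2; rewrite pmulr_rgt0 ?(lt_le_trans _ L_ge1) // => /ltW.
  have : 0 <= L * ML R k s by rewrite mulr_ge0 ?exprn_ge0 // ltW // ML_gt0.
  by move=> h; rewrite -[leLHS]mul1r; apply: ler_wpM2r => //; rewrite ler1n expn_gt0 (leq_trans _ A_ge2).
rewrite PE -[X in X * (_^-1 * _)]mulrC -mulrA [X in L * X]mulrA divff ?gt_eqF // mul1r.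
rewrite ME; apply: le_trans (cst _ _); last by move=> w /bnd[/ltW].
apply: ler_prod => w /bnd[h1 h2 h3]; rewrite h3 andbT.
by have := lt_le_trans h1 h2; rewrite pmulr_rgt0 ?(lt_le_trans _ L_ge1) // => /ltW.
Qed.

Lemma log2_le (x y : R) : 0 < x -> 0 < y -> (log2 x <= log2 y) = (x <= y).
Proof.
by move=> x0 y0; rewrite /log2 ler_pM2r ?invr_gt0 ?ln_gt0 ?ltr1n // ler_ln ?posrE.
Qed.

(** Brings polynomial factors to the scale exp (sqrt n) of the admissible penalties, so that one
    error term covers all criteria. *)
Lemma natS_le_expR_sqrt (n : nat) : n.+1%:R <= expR (2 * Num.sqrt n%:R) :> R.
Proof.
set x := Num.sqrt _; have x0 : 0 <= x by apply: sqrtr_ge0.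
have -> : n.+1%:R = 1 + x ^+ 2 :> R by rewrite sqr_sqrtr // -natr1 addrC.
apply: (@le_trans _ _ ((1 + x) ^+ 2)); first by rewrite sqrrD; lra.
rewrite expRM_natl; apply: lerXn2r; rewrite ?nnegrE ?expR_ge0 ?addr_ge0 //.
exact: expR_ge1Dx.
Qed.

Lemma le_expR (x : R) : x <= expR x.
Proof. by apply: le_trans (expR_ge1Dx x); rewrite lerDr. Qed.

(** Each criterion is a negative log-likelihood plus a correction. The correction at [k0] exceeds
    the one at [k] by at most a multiple of |A|^k0 sqrt n, because every bound is monotone in the
    order. *)
Lemma IC_le_ML (cr : criterion R) : criterion_ok cr ->
  exists C N, 0 <= C /\ forall (k k0 : nat) (s : seq A),
    (N <= size s)%N -> (k <= k0)%N -> (k0 < size s)%N ->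
    IC_value cr k s <= IC_value cr k0 s ->
    ML R k0 s <= expR (C * (#|A| ^ k0)%:R * Num.sqrt (size s)%:R) * ML R k s.
Proof.
set B := #|A|; have B0 : (0 < B)%N by apply: leq_trans A_ge2.
have Bk_ge1 k : 1 <= (B ^ k)%:R :> R by rewrite ler1n expn_gt0 B0.
have sqrt_ge1 n : (0 < n)%N -> 1 <= Num.sqrt n%:R :> R.
  by move=> n0; rewrite -[leLHS]sqrtr1 ler_sqrt // ler1n.
have pw n m : (n.+1%:R : R) ^+ m <= expR (2 * m%:R * Num.sqrt n%:R).
  have -> : 2 * m%:R * Num.sqrt n%:R = m%:R * (2 * Num.sqrt n%:R) :> R by ring.
  rewrite expRM_natl; apply: lerXn2r; rewrite ?nnegrE ?expR_ge0 //.
  exact: natS_le_expR_sqrt.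
have Bk_le n k : (0 < n)%N -> (B ^ k)%:R <= expR ((B ^ k)%:R * Num.sqrt n%:R) :> R.
  move=> n0; apply: le_trans (le_expR _) _; rewrite ler_expR -[leLHS]mulr1.
  by apply: ler_wpM2l => //; apply: sqrt_ge1.
have BS k : (B ^ k.+1)%:R = B%:R * (B ^ k)%:R :> R by rewrite expnS natrM.
case: cr => [pen|_|_] /=.
- move=> [_ [C [N hC]]]; exists (B%:R * `|C|), N; split; first by rewrite mulr_ge0.
  move=> k k0 s Ns kk0 k0s; have s0 : (0 < size s)%N by apply: leq_ltn_trans k0s.
  set n := size s in Ns k0s s0 *.
  have M0 := @ML_gt0 A R k s s0; have M00 := @ML_gt0 A R k0 s s0.
  rewrite /PML_crit -/n -/B => h.
  pose x j : R := ((B - 1) * B ^ j)%:R.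
  have xk0 : 0 <= x k0 - x k <= B%:R * (B ^ k0)%:R.
    rewrite subr_ge0 ler_nat leq_mul2l leq_pexp2l ?orbT //=.
    apply: (@le_trans _ _ (x k0)); first by rewrite gerBl.
    by rewrite /x natrM; apply: ler_wpM2r => //; rewrite ler_nat leq_subr.
  have h' : log2 (ML R k0 s) <= log2 (ML R k s) + (x k0 - x k) * pen n.
    by move: h; rewrite -/(x k) -/(x k0) mulrBl; lra.
  (* Only an upper bound on the penalty is used, as its coefficient is nonnegative; [C] itself may
     be negative, hence the absolute value. *)
  have penC : (x k0 - x k) * pen n <= B%:R * `|C| * (B ^ k0)%:R * Num.sqrt n%:R.
    apply: (@le_trans _ _ ((x k0 - x k) * (`|C| * Num.sqrt n%:R))).
      apply: ler_wpM2l; first by case/andP: xk0.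
      apply: le_trans (ler_norm _) _; apply: le_trans (hC _ Ns) _.
      by apply: ler_wpM2r; [apply: sqrtr_ge0|apply: ler_norm].
    have -> : B%:R * `|C| * (B ^ k0)%:R * Num.sqrt n%:R =
       B%:R * (B ^ k0)%:R * (`|C| * Num.sqrt n%:R) by ring.
    by apply: ler_wpM2r; [rewrite mulr_ge0 ?sqrtr_ge0|case/andP: xk0].
  set G := _ * Num.sqrt _ in penC *.
  have G0 : 0 <= G by rewrite !mulr_ge0 ?sqrtr_ge0.
  have ln20 : 0 < ln 2 :> R by rewrite ln_gt0 // ltr1n.
  have ln21 : ln 2 <= 1 :> R.
    by have := @le_ln1Dx R 1; rewrite [1 + 1](_ : _ = 2); [apply; lra|ring].
  rewrite -ler_ln ?posrE ?mulr_gt0 ?expR_gt0 // lnM ?posrE ?expR_gt0 // expRK.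
  have := le_trans h' (lerD (lexx _) penC); rewrite /log2 ler_pdivrMr // mulrDl divfK ?gt_eqF //.
  have : G * ln 2 <= G * 1 by apply: ler_wpM2l.
  by lra.
- exists (2 * B%:R + 1), 0%N; split; first by rewrite addr_ge0 ?mulr_ge0.
  move=> k k0 s _ kk0 k0s; have s0 : (0 < size s)%N by apply: leq_ltn_trans k0s.
  have ks : (k < size s)%N by apply: leq_ltn_trans k0s.
  set n := size s in k0s s0 ks *.
  have M0 := @ML_gt0 A R k s s0; have M00 := @ML_gt0 A R k0 s s0.
  rewrite /NML_crit -/n; set Sk := \sum_(y : n.-tuple A) ML R k y; set Sk0 := \sum_(y : n.-tuple A) ML R k0 y => h.
  have Sk1 : 1 <= Sk by apply: sum_ML_ge1.
  have Sk01 : 1 <= Sk0 by apply: sum_ML_ge1.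
  have Sk00 : 0 < Sk0 by apply: lt_le_trans Sk01.
  have h1 : log2 (ML R k0 s) <= log2 (ML R k s * Sk0).
    have -> : log2 (ML R k s * Sk0) = log2 (ML R k s) + log2 Sk0.
      by rewrite /log2 lnM ?posrE // mulrDl.
    have : 0 <= log2 Sk by rewrite /log2 divr_ge0 // ln_ge0 // ler1n.
    by move: h; lra.
  rewrite log2_le ?mulr_gt0 // in h1.
  apply: (le_trans h1); rewrite mulrC; apply: ler_wpM2r; first exact: ltW.
  apply: le_trans (sum_ML_le A R k0s) _; rewrite natrM natrX.
  have -> : (2 * B%:R + 1) * (B ^ k0)%:R * Num.sqrt n%:R =
     2 * (B ^ k0.+1)%:R * Num.sqrt n%:R + (B ^ k0)%:R * Num.sqrt n%:R :> R by rewrite BS; ring.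
  by rewrite expRD; apply: ler_pM; rewrite ?exprn_ge0 //; apply: Bk_le.
exists (20 * B%:R + 1), (Num.truncn (expR 1 : R)).+1; split; first by rewrite addr_ge0 ?mulr_ge0.
move=> k k0 s n3 kk0 k0s; have s0 : (0 < size s)%N by apply: leq_ltn_trans k0s.
have es : expR 1 <= (size s)%:R :> R.
  by apply: le_trans (ltW (truncnS_gt _)) _; rewrite ler_nat.
have [p1 p2 p3] := P_KT_bounds k s0 es.
have [p01 p02 p03] := P_KT_bounds k0 s0 es.
rewrite /KT_crit lerN2 log2_le // => h.
apply: (le_trans p03); set n := size s in k0s s0 es n3 p2 p3 p02 p03 *; rewrite -/B.
set L0 := n%:R ^+ (5 * B * B ^ k0) in p02 p03 *.
have n1 : 1 <= n%:R :> R by rewrite ler1n.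
have LL : n%:R ^+ (5 * B * B ^ k) <= L0.
  by apply: ler_weXn2l => //; rewrite leq_mul2l leq_pexp2l ?orbT.
have M0 := ltW (@ML_gt0 A R k s s0).
have L00 : 0 <= L0 by apply: exprn_ge0.
apply: (@le_trans _ _ ((B ^ k0)%:R * L0 * (L0 * ML R k s))).
  apply: ler_wpM2l; first by rewrite mulr_ge0.
  apply: (le_trans h); apply: (le_trans p2); exact: ler_wpM2r.
rewrite mulrA; apply: ler_wpM2r => //.
(* Each of the two factors [L0] accounts for 10 B, and the number of contexts for the remaining
   1. *)
have -> : (20 * B%:R + 1) * (B ^ k0)%:R * Num.sqrt n%:R =
   (B ^ k0)%:R * Num.sqrt n%:R + (2 * (5 * B * B ^ k0)%:R * Num.sqrt n%:R + 2 * (5 * B * B ^ k0)%:R * Num.sqrt n%:R) :> R.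
  by rewrite !natrM; ring.
have LE : L0 <= expR (2 * (5 * B * B ^ k0)%:R * Num.sqrt n%:R).
  apply: le_trans (pw n (5 * B * B ^ k0)%N); apply: lerXn2r; rewrite ?nnegrE // ler_nat.
  exact: leqnSn.
by rewrite !expRD -mulrA; apply: ler_pM; rewrite ?mulr_ge0 // ?Bk_le //; apply: ler_pM.
Qed.

End CriterionComparison.

(** * The law of the process *)

Section FiniteValued.
Variables (R : realType) (d : measure_display) (Omega : measurableType d).
Variables (P : probability Omega R) (T : finType) (Y : Omega -> T).
Hypothesis mY : forall t, measurable [set w | Y w = t].

Lemma probability_fin_partition (E : set Omega) : measurable E ->
  P E = (\sum_(t : T) P (E `&` [set w | Y w = t]))%E.
Proof.
move=> mE.
have key (s : seq T) : uniq s -> measurable (E `&` [set w | Y w \in s]) /\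
    P (E `&` [set w | Y w \in s]) = (\sum_(t <- s) P (E `&` [set w | Y w = t]))%E.
  elim: s => [_|a s IH /= /andP[aNs us]].
    have -> : E `&` [set w | Y w \in [::]] = set0.
      by apply/seteqP; split => // w [].
    by rewrite big_nil measure0.
  have {IH} [ms IH] := IH us.
  have -> : E `&` [set w | Y w \in a :: s] =
      (E `&` [set w | Y w = a]) `|` (E `&` [set w | Y w \in s]).
    apply/seteqP; split => w /=.
      by rewrite inE => -[Ew /orP[/eqP|]]; [left|right].
    by rewrite inE => -[[Ew ->]|[Ew ->]]; rewrite ?eqxx ?orbT.
  have ma : measurable (E `&` [set w | Y w = a]) by apply: measurableI.
  split; first exact: measurableU.
  rewrite measureU //; last first.
    by apply/seteqP; split => // w [[_ /= ->] [_]]; rewrite /= (negbTE aNs).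
  by rewrite big_cons -IH.
have [_ <-] := key (index_enum T) (index_enum_uniq T).
congr (P _); apply/seteqP; split => w /=; last by case.
by move=> Ew; split => //; rewrite mem_index_enum.
Qed.

Lemma fine_probability_fin_partition (E : set Omega) : measurable E ->
  fine (P E) = \sum_(t : T) fine (P (E `&` [set w | Y w = t])).
Proof.
move=> mE; rewrite probability_fin_partition // sum_fine // => t _.
by apply: fin_num_measure; apply: measurableI.
Qed.

Lemma measurable_fin_pred (S : pred T) : measurable [set w | S (Y w)].
Proof.
rewrite (_ : [set w | _] = \bigcup_(t in [set` S]) [set w | Y w = t]).
  apply: fin_bigcup_measurable => //; exact: finite_finset.
apply/seteqP; split => w /=; first by move=> h; exists (Y w).
by move=> [t /= ht ->].
Qed.

Lemma fine_probability_fin_pred (S : pred T) :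
  fine (P [set w | S (Y w)]) = \sum_(t | S t) fine (P [set w | Y w = t]).
Proof.
rewrite fine_probability_fin_partition; last exact: measurable_fin_pred.
rewrite [RHS]big_mkcond /=; apply: eq_bigr => t _.
case: ifPn => St.
  congr (fine (P _)); apply/seteqP; split => w /=; first by case.
  by move=> Yw; rewrite Yw.
rewrite (_ : _ `&` _ = set0) ?measure0 //.
by apply/seteqP; split => // w /= [St' Yt]; move: St; rewrite -Yt St'.
Qed.

End FiniteValued.

Section Blocks.
Variable A : Type.
Implicit Types x : int -> A.

Lemma block_rcons x s k : block x s k.+1 = rcons (block x s k) (x (s + k%:Z)).
Proof. by rewrite /block -addn1 iotaD map_cat /= add0n cats1. Qed.

Lemma block_cons x s k : block x s k.+1 = x s :: block x (s + 1) k.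
Proof.
rewrite /block /= addr0; congr cons.
rewrite -(addn0 1%N) iotaDl -map_comp; apply: eq_map => j /=.
by rewrite PoszD addrA.
Qed.

Lemma size_block x s k : size (block x s k) = k.
Proof. by rewrite size_map size_iota. Qed.

Lemma block_shift x s k : block (Defs.shift x) s k = block x (s + 1) k.
Proof. by apply: eq_map => j; rewrite /Defs.shift addrAC. Qed.

Lemma past_wordS x k : past_word x k.+1 = x (- k.+1%:Z) :: past_word x k.
Proof.
rewrite /past_word block_cons; congr (_ :: block _ _ _).
by rewrite -addn1 PoszD opprD addrNK.
Qed.

Lemma size_past_word x k : size (past_word x k) = k.
Proof. exact: size_block. Qed.

Lemma sigma_algebra_block s (u : seq A) :
  <<s @coord_sets A >> [set x | block x s (size u) = u].
Proof.
have sub (B : set (int -> A)) : <<s @coord_sets A >> B -> B `<=` setT by [].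
have [sT _ _ sI] := (sigma_algebraP sub).1 (smallest_sigma_algebra setT (@coord_sets A)).
elim/last_ind: u => [|u a IH].
  by rewrite (_ : [set _ | _] = setT) //; apply/seteqP; split.
rewrite (_ : [set _ | _] = [set x | block x s (size u) = u] `&` [set x | x (s + (size u)%:Z) = a]).
  apply: sI => //; apply: sub_sigma_algebra; by exists (s + (size u)%:Z), a.
apply/seteqP; split => x /=; rewrite size_rcons block_rcons.
  by move/rcons_inj => [-> ->].
by move=> [-> ->].
Qed.

End Blocks.

Section ProcessLaw.
Variables (R : realType) (d : measure_display) (Omega : measurableType d).
Variables (P : probability Omega R) (A : finType) (X : int -> Omega -> A).
Hypotheses (Xproc : is_process X) (Xstat : stationary P X).

Lemma measurable_block s (u : seq A) :
  measurable [set w | block (path_of X w) s (size u) = u].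
Proof.
elim/last_ind: u => [|u a IH].
  by rewrite (_ : [set _ | _] = setT) //; apply/seteqP; split.
rewrite (_ : [set _ | _] = [set w | block (path_of X w) s (size u) = u] `&`
   [set w | X (s + (size u)%:Z) w = a]); first by apply: measurableI.
apply/seteqP; split => w /=; rewrite size_rcons block_rcons.
  by move/rcons_inj => [e1 e2]; split.
by move=> [e1 e2]; rewrite e1 /path_of e2.
Qed.

Definition law (u : seq A) : R := block_prob P X 0 u.

Lemma block_prob_shift s (u : seq A) : block_prob P X (s + 1) u = block_prob P X s u.
Proof.
rewrite /block_prob; congr fine.
rewrite -[RHS](Xstat (sigma_algebra_block s u)); congr (P _).
by apply/seteqP; split => w /=; rewrite block_shift.
Qed.

Lemma block_probE s (u : seq A) : block_prob P X s u = law u.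
Proof.
rewrite /law; elim/int_ind: s => // n IH.
  by rewrite -IH -[RHS]block_prob_shift -addn1 PoszD.
by rewrite -IH -[LHS]block_prob_shift -addn1 PoszD opprD addrNK.
Qed.

Lemma law_stationary : stationary_law law.
Proof.
split.
- by move=> u; apply: fine_ge0.
- rewrite /law /block_prob (_ : [set _ | _] = setT) ?probability_setT //.
  by apply/seteqP; split.
- move=> u; rewrite /law /block_prob.
  rewrite [RHS](fine_probability_fin_partition P (Xproc (0 + (size u)%:Z)) (measurable_block _ _)).
  apply: eq_bigr => a _; congr (fine (P _)).
  apply/seteqP; split => w /=; rewrite size_rcons block_rcons.
    by move/rcons_inj => [e1 e2]; split.
  by move=> [e1 e2]; rewrite e1 /path_of e2.
move=> u; rewrite -(block_probE 1 u) /law /block_prob.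
rewrite [RHS](fine_probability_fin_partition P (Xproc 0) (measurable_block _ _)).
apply: eq_bigr => a _; congr (fine (P _)).
apply/seteqP; split => w /=; rewrite block_cons add0r.
  by case=> <- e; split.
by case=> e1 e2; rewrite e1 /path_of e2.
Qed.

Lemma probability_sample n (S : pred (seq A)) :
  P [set w | S (sample X w n)] = (\sum_(v : n.-tuple A | S v) law v)%:E.
Proof.
have sz w : size (sample X w n) == n by rewrite size_block.
pose Y w : n.-tuple A := Tuple (sz w).
have YE (v : n.-tuple A) : [set w | Y w = v] = [set w | block (path_of X w) 1 (size v) = v].
  apply/seteqP; split => w /=; first by move=> <-; rewrite /= size_block.
  by rewrite size_tuple => h; apply: val_inj.
have mY v : measurable [set w | Y w = v] by rewrite YE; apply: measurable_block.
rewrite -[LHS]fineK; last exact: fin_num_measure (measurable_fin_pred mY (fun v : n.-tuple A => S v)).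
congr EFin; rewrite (fine_probability_fin_pred P mY (fun v : n.-tuple A => S v)).
by apply: eq_bigr => v _; rewrite YE -(block_probE 1).
Qed.

End ProcessLaw.

(** * Continuity and non-nullness read on finite words *)

Section ProcessContinuity.
Variables (R : realType) (d : measure_display) (Omega : measurableType d).
Variables (P : probability Omega R) (A : finType) (X : int -> Omega -> A).
Hypotheses (Xproc : is_process X) (Xstat : stationary P X).
Implicit Types (u v w : seq A) (x : int -> A).

Let p := law P X.
Let plaw : stationary_law p := law_stationary Xproc Xstat.
Let p_ge0 u : 0 <= p u. Proof. by case: plaw. Qed.

Lemma admissible_pastE x :
  admissible_past P X x <-> forall k, 0 < p (past_word x k).
Proof. by split => h k; have := h k; rewrite block_probE. Qed.

Lemma condPE x k a : condP P X x k a = cond p (past_word x k) a.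
Proof. by rewrite /condP !block_probE. Qed.

Lemma past_word_suffix x k j : (k <= j)%N -> lastn k (past_word x j) = past_word x k.
Proof.
elim: j => [|j IH]; first by rewrite leqn0 => /eqP->.
rewrite leq_eqVlt => /predU1P[->|].
  by rewrite -{1}(size_past_word x j.+1) lastn_id.
by rewrite ltnS => kj; rewrite past_wordS (@lastn_cat _ _ [:: _]) ?IH ?size_past_word.
Qed.

(* Extend to the left by letters keeping the probability positive. *)
Lemma extend_admissible (a0 : A) w : 0 < p w ->
  exists2 x, admissible_past P X x & past_word x (size w) = w.
Proof.
move=> pw; pose next u := if [pick a | 0 < p (a :: u)] is Some a then a :: u else u.
have next_ok u : 0 < p u -> exists2 a, next u = a :: u & 0 < p (a :: u).
  move=> pu; rewrite /next; case: pickP => [a pa|no]; first by exists a.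
  have [_ _ _ /(_ u) s] := plaw; move: pu; rewrite -s big1 ?ltxx // => a _.
  by apply/le_anti; rewrite p_ge0 andbT leNgt no.
pose E j := iter j next w.
have E_gt0 j : 0 < p (E j).
  by elim: j => // j IH; rewrite /E iterS; have [a ->] := next_ok _ IH.
have ES j : exists a, E j.+1 = a :: E j.
  by have [a e _] := next_ok _ (E_gt0 j); exists a.
have Esize j : size (E j) = (j + size w)%N.
  by elim: j => // j IH; have [a ->] := ES j; rewrite /= IH.
have Ecat i j : exists z, E (i + j)%N = z ++ E i.
  elim: j => [|j [z IH]]; first by exists [::]; rewrite addn0.
  by rewrite addnS; have [a ->] := ES (i + j)%N; exists (a :: z); rewrite IH.
(* [y m] is the letter at coordinate - (m + 1), counted from the right end; every sufficiently long
   [E j] gives the same one. *)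
pose y m := nth a0 (rev (E m.+1)) m.
have yE m j : (m < size (E j))%N -> y m = nth a0 (rev (E j)) m.
  move=> mj; have mm : (m < size (E m.+1))%N by rewrite Esize addSn ltnS leq_addr.
  rewrite /y; have [h|h] := leqP m.+1 j.
    have [z] := Ecat m.+1 (j - m.+1)%N; rewrite subnKC // => ->.
    by rewrite rev_cat nth_cat size_rev mm.
  have [z] := Ecat j (m.+1 - j)%N; rewrite subnKC 1?ltnW // => ->.
  by rewrite rev_cat nth_cat size_rev mj.
pose x (i : int) : A := if i is Negz m then y m else a0.
have xE k j : (k <= size (E j))%N -> past_word x k = lastn k (E j).
  elim: k => [|k IH] kj; first by rewrite /lastn subn0 drop_size.
  rewrite past_wordS IH 1?ltnW // -NegzE /= (yE k j) //.
  rewrite /lastn nth_rev // -[in X in _ :: drop X _](subnSK kj) -drop_nth //.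
  by rewrite subnSK // leq_subr.
exists x; last by rewrite (xE _ 0%N) // lastn_id.
apply/admissible_pastE => k.
have kE : (k <= size (E k))%N by rewrite Esize leq_addr.
rewrite (xE k k) //; apply: (law_suffix_gt0 plaw (x := take (size (E k) - k) (E k))).
by rewrite lastnK.
Qed.

Variables (D rho : R) (g : nat -> R) (a0 : A).
Hypotheses (D_gt0 : 0 < D) (rho_gt0 : 0 < rho) (rho_lt1 : rho < 1).
Hypothesis gamma_bar_le : forall k, gamma_bar P X k <= D * rho ^+ k.
Hypothesis gamma_low_ge : forall k, g k <= gamma_low P X k.

Lemma condP_itv x k a : 0 <= condP P X x k a <= 1.
Proof.
rewrite condPE cond_ge0 //=; apply: le_trans (sum_cond_le1 plaw (past_word x k)).
by rewrite (bigD1 a) //= lerDl sumr_ge0 // => b _; apply: cond_ge0.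
Qed.

(** A supremum bounds its members only once the set is known to be bounded, and convergence is
    deduced from that later. A divergent limit, which is the default [point], must therefore be
    allowed for here. *)
Lemma condP_inf_bounded x a : `|condP_inf P X x a| <= 1 + `|point : R|.
Proof.
rewrite /condP_inf; have [h|/dvgP->] := pselect (cvgn (condP P X x ^~ a)); last by rewrite lerDr.
apply: (@le_trans _ _ 1); last by rewrite lerDl.
rewrite ler_norml; apply/andP; split.
  apply: limr_ge => //; near=> k; apply: (@le_trans _ _ 0); first by rewrite lerN10.
  by have /andP[] := condP_itv x k a.
by apply: limr_le => //; near=> k; have /andP[] := condP_itv x k a.
Unshelve. all: by end_near.
Qed.

Lemma cont_dev_le x k : admissible_past P X x -> cont_dev P X x k <= D * rho ^+ k.
Proof.
move=> xa; apply: le_trans (gamma_bar_le k); apply: ub_le_sup; last by exists x.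
exists (\sum_(a : A) (1 + (1 + `|point : R|))) => _ [z _ <-].
apply: ler_sum => a _; apply: le_trans (ler_normB _ _) _; apply: lerD.
  by have /andP[h0 h1] := condP_itv z k a; rewrite ger0_norm.
exact: condP_inf_bounded.
Qed.

Lemma cont_dev_ge x k : admissible_past P X x -> g k <= cont_dev P X x k.
Proof.
move=> xa; apply: le_trans (gamma_low_ge k) _; apply: ge_inf; last by exists x.
by exists 0 => _ [z _ <-]; apply: sumr_ge0.
Qed.

Lemma le_of_geometric_slack (y z : R) : (forall k, z <= y + D * rho ^+ k) -> z <= y.
Proof.
move=> h; have lim : (fun k => y + D * rho ^+ k) @ \oo --> y + D * 0.
  by apply: cvgD; [apply: cvg_cst|apply: cvgMr; apply: cvg_expr; rewrite gtr0_norm].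
rewrite -[y]addr0 -(mulr0 D) -(cvg_lim _ lim) //.
by apply: limr_ge; [apply/cvg_ex; eexists; exact: lim|near=> k].
Unshelve. all: by end_near.
Qed.

Lemma condP_near x k a : admissible_past P X x ->
  `|condP P X x k a - condP_inf P X x a| <= D * rho ^+ k.
Proof.
move=> xa; apply: le_trans (cont_dev_le k xa).
by rewrite /cont_dev (bigD1 a) //= lerDl sumr_ge0.
Qed.

Lemma condP_inf_ge0 x a : admissible_past P X x -> 0 <= condP_inf P X x a.
Proof.
move=> xa; apply: le_of_geometric_slack => k.
have := condP_near k a xa; have /andP[h _] := condP_itv x k a.
by rewrite ler_norml => /andP[_]; lra.
Qed.

(** Both conditional laws are compared with the one given an admissible past extending [x ++ w];
    hence 2 D. *)
Lemma law_cont (x w : seq A) : 0 < p (x ++ w) ->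
  \sum_a `|cond p (x ++ w) a - cond p w a| <= 2 * D * rho ^+ size w.
Proof.
move=> /(extend_admissible a0)[y ya yE].
have yw : past_word y (size w) = w.
  rewrite -(@past_word_suffix _ _ (size (x ++ w))) ?yE ?lastn_cat ?lastn_id //.
  by rewrite size_cat leq_addl.
have h1 := cont_dev_le (size (x ++ w)) ya; have h2 := cont_dev_le (size w) ya.
have h3 : D * rho ^+ size (x ++ w) <= D * rho ^+ size w.
  by apply: ler_wpM2l; [rewrite ltW|rewrite ler_wiXn2l // ?size_cat ?leq_addl // ltW].
apply: (@le_trans _ _ (cont_dev P X y (size (x ++ w)) + cont_dev P X y (size w))).
  rewrite -big_split /=; apply: ler_sum => a _.
  rewrite !condPE yE yw [X in _ <= _ + X]distrC.
  by apply: le_trans (ler_normD _ _); rewrite addrA subrK.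
by move: h1 h2 h3; rewrite -mulrA; lra.
Qed.

(** The long word [x ++ w] stands in for the infinite past, at the price of its own continuity
    rate. *)
Lemma law_gap (x w : seq A) : 0 < p (x ++ w) ->
  g (size w) - D * rho ^+ size (x ++ w) <= \sum_a `|cond p (x ++ w) a - cond p w a|.
Proof.
move=> /(extend_admissible a0)[y ya yE].
have yw : past_word y (size w) = w.
  rewrite -(@past_word_suffix _ _ (size (x ++ w))) ?yE ?lastn_cat ?lastn_id //.
  by rewrite size_cat leq_addl.
have h1 := cont_dev_le (size (x ++ w)) ya; have h2 := cont_dev_ge (size w) ya.
rewrite lerBlDr; apply: (le_trans h2).
apply: le_trans (lerD (lexx _) h1); rewrite -big_split /=; apply: ler_sum => a _.
rewrite !condPE yE yw [X in _ <= X + _]distrC.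
by apply: le_trans (ler_normD _ _); rewrite addrA subrK.
Qed.

Definition inf_cond (a : A) : R := inf [set condP_inf P X x a | x in admissible_past P X].

(** Conditioning on [w] averages over its left extensions by [m] letters, each within D rho^m of an
    infinite-past value; let [m] grow. *)
Lemma law_cond_ge w a : 0 < p w -> inf_cond a <= cond p w a.
Proof.
move=> pw; apply: le_of_geometric_slack => m.
rewrite -(ler_pM2l pw) mulrDr -(law_condE plaw) -lerBlDr -mulrBr.
rewrite -(sum_law_cat plaw m (rcons w a)) -{1}(sum_law_cat plaw m w) mulr_suml.
apply: ler_sum => x _; rewrite -rcons_cat (law_condE plaw).
have := p_ge0 (x ++ w); rewrite le_eqVlt => /predU1P[<-|pxw]; first by rewrite !mul0r.
apply: ler_wpM2l => //; have [y ya yE] := extend_admissible a0 pxw.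
apply: (@le_trans _ _ (condP_inf P X y a - D * rho ^+ m)).
  rewrite lerD2r; apply: ge_inf; last by exists y.
  by exists 0 => _ [z za <-]; apply: condP_inf_ge0.
have := condP_near (size (x ++ w)) a ya; rewrite condPE yE ler_norml => /andP[h _].
have : D * rho ^+ size (x ++ w) <= D * rho ^+ m.
  apply: ler_wpM2l; first exact: ltW.
  by rewrite ler_wiXn2l // ?size_cat ?size_tuple ?leq_addr // ltW.
by move: h; lra.
Qed.

End ProcessContinuity.

(** * Underestimation of the order *)

Section Underestimation.
Variables (R : realType) (A : finType).
Hypothesis A_ge2 : (2 <= #|A|)%N.

(** The search returns [size s] when it fails; the bound on [khat] excludes this. *)
Lemma khatP (cr : criterion R) (s : seq A) (j : nat) :
  (khat cr s < size s)%N -> (j < size s)%N ->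
  IC_value cr (khat cr s) s <= IC_value cr j s.
Proof.
rewrite /khat => ks js; set pr := fun k => _ in ks *; set l := iota 0 _ in pr ks *.
have hp : has pr l by rewrite has_find size_iota.
have := nth_find 0%N hp; rewrite {1}/l nth_iota // add0n => /allP; apply.
by rewrite mem_iota.
Qed.

Variable p : seq A -> R.
Hypothesis plaw : stationary_law p.
Variables (D rho : R).
Hypotheses (D_gt0 : 0 < D) (rho_gt0 : 0 < rho) (rho_lt1 : rho < 1).
Hypothesis cont : forall x w, 0 < p (x ++ w) ->
  \sum_a `|cond p (x ++ w) a - cond p w a| <= 2 * D * rho ^+ size w.

(** Outside [smooth_bad], the true likelihood is at most exp (sig) times that of the smoothed chain,
    hence at most exp (sig) ML_k0, hence exp (sig + Del) ML_k, hence exp (sig + Del) times the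
    likelihood of some count kernel: that kernel satisfies [ratio_bad]. *)
Lemma khat_small_prob (cr : criterion R) (thr gm th Del sig : R) (n k0 J s0 M : nat) :
  (forall k, k%:R <= thr -> (k <= k0)%N /\ (k <= s0)%N) ->
  (forall k x w, k%:R <= thr -> size w = k -> 0 < p (x ++ w) ->
    gm - D * rho ^+ size (x ++ w) <= \sum_a `|cond p (x ++ w) a - cond p w a|) ->
  0 < th <= 1 ->
  (forall u u', 0 < p u -> 0 < p u' -> th <= overlap p s0 u u') ->
  (0 < J)%N -> 0 < gm -> gm <= 1 ->
  2 * (1 - th) ^+ J + 4 * D / (1 - rho) * rho ^+ s0 <= th * (gm / 8) ->
  D * rho ^+ (J * s0) <= gm / 2 -> D * rho ^+ k0 <= 1 ->
  (k0 < n)%N -> (M * (J * s0).+1 <= n - k0)%N ->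
  (forall k (s : n.-tuple A), (k <= k0)%N -> IC_value cr k s <= IC_value cr k0 s ->
    ML R k0 s <= expR Del * ML R k s) ->
  \sum_(s : n.-tuple A | (khat cr s)%:R <= thr) p s <=
    expR (- sig) * (1 + 16 * #|A|%:R * (D * rho ^+ k0)) ^+ (n - k0) +
    (k0.+1 * n.+1 ^ (#|A| ^ k0.+1))%:R *
      (expR ((sig + Del) / 2) * (1 - (gm / 64) ^+ 2) ^+ M).
Proof.
move=> thrk gap th01 hth J0 gm0 gm2 h1 h2 e1 k0n MT hIC.
have A0 : (0 < #|A|)%N by apply: leq_trans A_ge2.
have [p0 p1 _ _] := plaw.
set e := D * rho ^+ k0; have e0 : 0 < e by rewrite mulr_gt0 ?exprn_gt0.
pose Q := smooth_cond p k0 e.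
pose c := cond p.
pose small (s : seq A) := (khat cr s)%:R <= thr.
pose F (s : seq A) := if small s then p s else 0.
pose smooth_bad (u v : seq A) := expR sig * lik Q u v <= lik c u v.
pose ratio_bad (q : seq A -> A -> R) (u v : seq A) :=
  expR (- (2 * ((sig + Del) / 2))) * lik c u v <= lik q u v.
have b0 : 0 <= 1 - (gm / 64) ^+ 2 by rewrite subr_ge0 exprn_ile1 //; lra.
have nE : n = (k0 + (n - k0))%N by rewrite subnKC // ltnW.
rewrite big_mkcond /= (big_tuple_split _ F (ltnW k0n)).
pose I k := {ffun k.+1.-tuple A -> 'I_n.+1}.
have incl (u : k0.-tuple A) (v : (n - k0).-tuple A) :
    F (u ++ v) <= (smooth_bad u v)%:R * p (u ++ v) +
      \sum_(k < k0.+1 | k%:R <= thr) \sum_(N : I k)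
         (ratio_bad (count_kernel R N) u v)%:R * p (u ++ v).
  rewrite /F /small; set s := u ++ v.
  have ss : size s = n by rewrite /s size_cat !size_tuple -nE.
  have sum0 : 0 <= \sum_(k < k0.+1 | k%:R <= thr) \sum_(N : I k)
         (ratio_bad (count_kernel R N) u v)%:R * p s.
    by apply: sumr_ge0 => k _; apply: sumr_ge0 => N _; rewrite mulr_ge0.
  have [kthr|_] := boolP ((khat cr s)%:R <= thr); last first.
    by rewrite addr_ge0 // mulr_ge0.
  have [bad|good] := boolP (smooth_bad u v).
    by rewrite mul1r lerDl.
  rewrite mul0r add0r; set k := khat cr s in kthr *.
  have [kk0 _] := thrk _ kthr.
  have kn : (khat cr s < size s)%N by rewrite ss; apply: leq_ltn_trans kk0 k0n.
  have tk : size s == n by rewrite ss.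
  have k0s : (k0 < size s)%N by rewrite ss.
  have hML := hIC k (Tuple tk) kk0 (khatP kn k0s); rewrite /= in hML.
  have [N hN] := ML_le_count_kernel R kk0 k0s.
  have takeu : take k0 s = u by rewrite /s take_cat size_tuple ltnn subnn take0 cats0.
  have dropv : drop k0 s = v by rewrite /s drop_cat size_tuple ltnn subnn drop0.
  rewrite takeu dropv in hN.
  have hQ : lik Q u v <= ML R k0 s.
    rewrite -[in leLHS]takeu -[in leLHS]dropv; apply: lik_le_ML => //.
    - exact: smooth_cond_dep.
    - by move=> w a; apply/ltW/smooth_cond_gt0.
    - by move=> w; apply: sum_smooth_cond_le1.
  move: N hN; rewrite ss => N hN.
  rewrite (bigD1 (Ordinal (kk0 : (k < k0.+1)%N))) //= (bigD1 N) //=.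
  have -> : ratio_bad (count_kernel R N) u v.
    rewrite /ratio_bad; have -> : 2 * ((sig + Del) / 2) = sig + Del by field.
    rewrite expRN ler_pdivrMl ?expR_gt0 //.
    move: good; rewrite /smooth_bad -ltNge => /ltW /le_trans; apply.
    rewrite expRD -mulrA; apply: ler_wpM2l; first exact: expR_ge0.
    apply: (le_trans hQ); apply: (le_trans hML).
    by apply: ler_wpM2l; first exact: expR_ge0.
  rewrite mul1r -addrA lerDl addr_ge0 //.
    by apply: sumr_ge0 => N' _; rewrite mulr_ge0.
  by apply: sumr_ge0 => k' _; apply: sumr_ge0 => N' _; rewrite mulr_ge0.
apply: le_trans (ler_sum _ (fun u _ => ler_sum _ (fun v _ => incl u v))) _.
under eq_bigr do rewrite big_split.
rewrite big_split /=; apply: lerD.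
  apply: le_trans (likelihood_smooth_test plaw cont A0 e0 e1 erefl (n - k0) sig).
  apply: ler_sum => u _; rewrite [leRHS]big_mkcond; apply: ler_sum => v _.
  by rewrite /smooth_bad; case: ifP => _; rewrite ?mul1r ?mul0r.
set t := (sig + Del) / 2; set W := expR t * _ ^+ M.
have W0 : 0 <= W by rewrite mulr_ge0 ?expR_ge0 ?exprn_ge0.
have one (k : 'I_k0.+1) (N : I k) : k%:R <= thr ->
    \sum_(u : k0.-tuple A) \sum_(v : (n - k0).-tuple A)
      (ratio_bad (count_kernel R N) u v)%:R * p (u ++ v) <= W.
  move=> kthr; have [kk0 ks0] := thrk _ kthr.
  apply: le_trans (likelihood_ratio_test (p := p) (q := count_kernel R N) (T := (J * s0).+1)
     (b := 1 - (gm / 64) ^+ 2) (n := n - k0) plaw _ _ t _ b0 MT).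
  - apply: ler_sum => u _; rewrite [leRHS]big_mkcond; apply: ler_sum => v _.
    by rewrite /ratio_bad; case: ifP => _; rewrite ?mul1r ?mul0r.
  - exact: count_kernel_ge0.
  - exact: sum_count_kernel_le1.
  - move=> u ku; apply: (affinity_block plaw D_gt0 rho_gt0 rho_lt1 cont _ _ _ _ u th01 hth ks0) => //.
    + exact: count_kernel_ge0.
    + exact: sum_count_kernel_le1.
    + exact: count_kernel_dep.
    + by move=> x w sw; apply: (gap k).
have step1 (u : k0.-tuple A) : \sum_(v : (n - k0).-tuple A) \sum_(k < k0.+1 | k%:R <= thr)
    \sum_(N : I k) (ratio_bad (count_kernel R N) u v)%:R * p (u ++ v) =
  \sum_(k < k0.+1 | k%:R <= thr) \sum_(N : I k) \sum_(v : (n - k0).-tuple A)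
    (ratio_bad (count_kernel R N) u v)%:R * p (u ++ v).
  by rewrite exchange_big; apply: eq_bigr => k _; rewrite exchange_big.
under eq_bigr do rewrite step1.
rewrite exchange_big /=.
under eq_bigr do rewrite exchange_big /=.
apply: (@le_trans _ _ (\sum_(k < k0.+1 | k%:R <= thr) (n.+1 ^ (#|A| ^ k0.+1))%:R * W)).
  apply: ler_sum => k kthr.
  apply: (@le_trans _ _ (\sum_(N : I k) W)); first by apply: ler_sum => N _; apply: one.
  rewrite sumr_const card_ffun card_tuple card_ord -[leLHS]mulr_natl.
  apply: ler_wpM2r => //; rewrite ler_nat leq_pexp2l // leq_pexp2l //.
rewrite natrM -mulrA big_mkcond /=.
apply: (@le_trans _ _ (\sum_(k < k0.+1) (n.+1 ^ (#|A| ^ k0.+1))%:R * W)).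
  by apply: ler_sum => k _; case: ifP => _ //; rewrite mulr_ge0.
by rewrite sumr_const card_ord -[leLHS]mulr_natl.
Qed.

End Underestimation.

(** * Choice of the parameters *)

Section Asymptotics.
Variable R : realType.

Lemma expR_ln_large (s C : R) : 0 < s ->
  exists2 N : nat, (0 < N)%N & forall n : nat, (N <= n)%N -> C <= expR (s * ln n%:R).
Proof.
move=> s0; exists (Num.truncn (expR (C / s))).+1 => // n Nn.
apply: le_trans (le_expR _); rewrite mulrC -ler_pdivrMr // -[leLHS]expRK.
rewrite ler_ln ?posrE ?expR_gt0 ?ltr0n ?(leq_trans _ Nn) //.
by apply: le_trans (ltW (truncnS_gt _)) _; rewrite ler_nat.
Qed.

Lemma expr_le_expR (x : R) (n : nat) : 0 <= x -> x ^+ n <= expR ((x - 1) * n%:R).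
Proof.
move=> x0; rewrite mulrC expRM_natl; apply: lerXn2r; rewrite ?nnegrE ?expR_ge0 //.
by have := expR_ge1Dx (x - 1); rewrite subrKC.
Qed.

Lemma expR1_ge2 : 2 <= expR 1 :> R.
Proof. by have := expR_ge1Dx (1 : R); rewrite [1 + 1](_ : _ = 2) //; ring. Qed.

(** In powers of n: |A|^k0 <= n^(a/4), gm is of order n^(a/2 - 1/4), and the block length is
    O(n^(a/8)). So gm^2 M is at least of order n^(1/2 + 7a/8), against losses of order n^(1/2 +
    a/4). *)
Lemma asymptotic_parameters (B : nat) (C0 D z1 z2 dl th : R) :
  let a := 6 * ln B%:R / z1 in
  let rho := expR (- z1) in
  (2 <= B)%N -> 0 <= C0 -> 0 < D -> 0 < z1 -> z1 <= z2 -> 0 < dl <= 1 -> 0 < th <= 1 ->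
  a < 2^-1 ->
  exists N : nat, forall n : nat, (N <= n)%N -> exists k0 J s0 M gm,
  let thr := (2^-1 - a) / (2 * z2) * ln n%:R in
  let Del := C0 * (B ^ k0)%:R * Num.sqrt n%:R in
  let sig := Num.sqrt n%:R in
  [/\ forall k : nat, k%:R <= thr -> (k <= k0)%N /\ (k <= s0)%N,
      forall k : nat, k%:R <= thr -> gm <= dl * expR (- z2 * k%:R),
      (0 < J)%N /\ 0 < gm /\ gm <= 1,
      2 * (1 - th) ^+ J + 4 * D / (1 - rho) * rho ^+ s0 <= th * (gm / 8) /\
      D * rho ^+ (J * s0) <= gm / 2 &
      [/\ D * rho ^+ k0 <= 1, (k0 < n)%N, (M * (J * s0).+1 <= n - k0)%N &
      expR (- sig) * (1 + 16 * B%:R * (D * rho ^+ k0)) ^+ (n - k0) +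
      (k0.+1 * n.+1 ^ (B ^ k0.+1))%:R *
        (expR ((sig + Del) / 2) * (1 - (gm / 64) ^+ 2) ^+ M) <=
      expR (- expR (4^-1 * ln n%:R))]].
Proof.
move=> a rho B2 C00 D0 z10 z12 /andP[dl0 dl1] /andP[th0 th1] a2.
have z20 : 0 < z2 by apply: lt_le_trans z12.
have lnB : 0 < ln B%:R :> R by rewrite ln_gt0 // ltr1n.
have a0 : 0 < a by rewrite divr_gt0 ?mulr_gt0.
have rho0 : 0 < rho by apply: expR_gt0.
have rho1 : rho < 1 by rewrite -[ltRHS]expR0 ltr_expR oppr_lt0.
have r1 : 0 < 1 - rho by rewrite subr_gt0.
pose kap := 3 / 2 / z1; have kap0 : 0 < kap by rewrite !divr_gt0.
(* With [s0] above C ln n, the three summands give in turn (1 - th)^s0 <= 1/n, rho^s0 <= 1/n and k0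
   <= s0. *)
pose C := th^-1 + z1^-1 + kap.
have C_gt0 : 0 < C by rewrite !addr_gt0 ?invr_gt0.
(* From ln n <= (16 / a) n^(a/16): the block length s0^2 + 1 is at most C1 n^(a/8). *)
pose C1 := (16 * C / a + 2) ^+ 2.
have C10 : 0 < C1 by rewrite exprn_gt0 // addr_gt0 // divr_gt0 // mulr_gt0.
(* Collects the losses in units of n^(1/2 + a/4): 1 for the choice of k, 2 B for the number of
   kernels, 1 + C0 for [sig] and [Del]. The later C2 + 2 also pays for the target exponent and the
   factor 1/2. *)
pose C2 := 2 + 2 * B%:R + C0.
have C20 : 0 < C2 by rewrite ltr_wpDr // addr_gt0 // mulr_gt0 // ltr0n (leq_trans _ B2).
pose K := 16 * B%:R * (D * expR z1).
have K0 : 0 <= K by rewrite !mulr_ge0 ?expR_ge0 // ltW.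
pose cc := (dl / 64) ^+ 2 / (2 * C1).
have cc0 : 0 < cc by apply: divr_gt0; [apply: exprn_gt0; apply: divr_gt0|apply: mulr_gt0].
have aE : a = 6 * ln B%:R / z1 by [].
have kapE : kap = 3 / 2 / z1 by [].
have CE : C = th^-1 + z1^-1 + kap by [].
have C1E : C1 = (16 * C / a + 2) ^+ 2 by [].
have C2E : C2 = 2 + 2 * B%:R + C0 by [].
have KE : K = 16 * B%:R * (D * expR z1) by [].
have ccE : cc = (dl / 64) ^+ 2 / (2 * C1) by [].
clearbody cc K C2 C1 C kap a.
have q1 : 0 < 3 / 4 :> R by lra.
have q2 : 0 < 7 / 8 :> R by lra.
have q3 : 0 < 3 / 2 :> R by lra.
have q4 : 0 < 5 * a / 8 by lra.
have q5 : 0 < 4^-1 :> R by lra.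
(* The five thresholds serve the two mixing conditions, k0 + T <= n / 2, D rho^k0 <= 1, the
   union-bound term and the chi-square term. *)
have [N1 N10 H1] := expR_ln_large ((2 + 4 * D / (1 - rho)) * 8 / (th * dl) + 2 * D / dl) q1.
have [N2 N20 H2] := expR_ln_large (4 + 4 * C1) q2.
have [N3 N30 H3] := expR_ln_large (D * expR z1) q3.
have [N4 N40 H4] := expR_ln_large ((C2 + 2) / cc) q4.
have [N5 N50 H5] := expR_ln_large (2 + K) q5.
exists (maxn N1 (maxn N2 (maxn N3 (maxn N4 N5)))) => n.
rewrite !geq_max => /andP[n1 /andP[n2 /andP[n3 /andP[n4 n5]]]].
have n0 : (0 < n)%N by apply: leq_trans n1.
move: {H1 H2 H3 H4 H5 n1 n2 n3 n4 n5}(H1 n n1) (H2 n n2) (H3 n n3) (H4 n n4) (H5 n n5).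
move=> H1 H2 H3 H4 H5.
set y := ln n%:R in H1 H2 H3 H4 H5 *.
have y0 : 0 <= y by rewrite ln_ge0 // ler1n.
have nE : n%:R = expR y by rewrite lnK // posrE ltr0n.
clearbody y.
pose X s := expR (s * y).
have X0 s : 0 < X s by apply: expR_gt0.
have XD s t : X s * X t = X (s + t) by rewrite /X -expRD mulrDl.
have Xle s t : s <= t -> X s <= X t by move=> st; rewrite ler_expR; apply: ler_wpM2r.
have X1 s : 0 <= s -> 1 <= X s by move=> s0; rewrite -[leLHS]expR0 ler_expR mulr_ge0.
have nX : n%:R = X 1 by rewrite nE /X mul1r.
have sqX : Num.sqrt n%:R = X 2^-1.
  have -> : n%:R = X 2^-1 ^+ 2 by rewrite nX expr2 XD; congr X; field.
  by rewrite sqrtr_sqr gtr0_norm.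
have Xinv s : X s * X (- s) = 1 by rewrite XD subrr /X mul0r expR0.
pose k0 := Num.truncn (kap * y); pose s0 := (Num.truncn (C * y)).+1.
pose T := (s0 * s0).+1; pose M := ((n - k0) %/ T)%N.
(* The lower continuity rate at the largest order considered: z2 * thr = (1/4 - a/2) ln n. *)
pose gm := dl * X (- (4^-1 - a / 2)).
exists k0, s0, s0, M, gm => thr Del sig.
have kapy : 0 <= kap * y by rewrite mulr_ge0 // ltW.
have Cy : 0 <= C * y by rewrite mulr_ge0 // ltW.
have thr_kap : thr <= kap * y.
  apply: ler_wpM2r => //; rewrite kapE.
  apply: (@le_trans _ _ (2^-1 / (2 * z2))).
    by apply: ler_wpM2r; [rewrite invr_ge0 mulr_ge0 // ltW|lra].
  apply: (@le_trans _ _ (2^-1 / (2 * z1))).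
    by apply: ler_wpM2l => //; rewrite lef_pV2 ?posrE ?mulr_gt0 // ler_pM2l.
  rewrite invfM mulrA; apply: ler_wpM2r; first by rewrite invr_ge0 ltW.
  by lra.
have kapC : kap * y <= C * y.
  by apply: ler_wpM2r => //; rewrite CE lerDr addr_ge0 // invr_ge0 ltW.
have k0_le : k0%:R <= kap * y by rewrite truncn_le.
have k0_gt : kap * y - 1 < k0%:R by have := truncnS_gt (kap * y); rewrite -natr1 -/k0; clear; lra.
have s0_ge : C * y <= s0%:R by apply/ltW/truncnS_gt.
have s0_le : s0%:R <= C * y + 1 by rewrite /s0 -natr1 lerD2r truncn_le.
have Bk0 : (B ^ k0)%:R <= X (a / 4).
  have B0R : 0 < B%:R :> R by rewrite ltr0n (leq_trans _ B2).
  rewrite natrX -[B%:R]lnK ?posrE // -expRM_natl ler_expR.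
  have -> : a / 4 * y = kap * y * ln B%:R.
    by rewrite aE kapE; field; rewrite gt_eqF.
  by apply: ler_wpM2r => //; apply: ltW.
have rhok0 : D * rho ^+ k0 <= D * expR z1 * X (- (3 / 2)).
  rewrite -mulrA; apply: ler_wpM2l; first exact: ltW.
  rewrite /rho -expRM_natl -expRD ler_expR.
  have : z1 * (kap * y - 1) <= z1 * k0%:R by apply: ler_wpM2l; apply: ltW.
  rewrite kapE mulrBr mulr1.
  have -> : z1 * (3 / 2 / z1 * y) = 3 / 2 * y by field; rewrite gt_eqF.
  by clear; lra.
have Dk0_le1 : D * rho ^+ k0 <= 1.
  apply: (le_trans rhok0); rewrite -[leRHS](Xinv (3 / 2)).
  by apply: ler_wpM2r; [apply: ltW|exact: H3].
have a_y : y <= 16 / a * X (a / 16).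
  have : a / 16 * y <= X (a / 16) by apply: le_expR.
  have -> : a / 16 * y = y / (16 / a) by field; rewrite gt_eqF.
  by rewrite ler_pdivrMr ?divr_gt0 // => h; apply: (le_trans h); rewrite mulrC.
have TX : T%:R <= C1 * X (a / 8).
  have s0X : s0%:R + 1 <= (16 * C / a + 2) * X (a / 16).
    have h : C * y <= 16 * C / a * X (a / 16).
      have -> : 16 * C / a * X (a / 16) = C * (16 / a * X (a / 16)) by ring.
      by apply: ler_wpM2l => //; apply: ltW.
    have a16 : 0 <= a / 16 by rewrite divr_ge0 // ltW.
    have := X1 _ a16.
    by rewrite mulrDl; move: s0_le h; clear; lra.
  apply: (@le_trans _ _ ((s0%:R + 1) ^+ 2)).
    rewrite /T -natr1 natrM sqrrD; have : 0 <= s0%:R :> R by [].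
    by rewrite expr1n expr2 mulr1; clear; lra.
  apply: (@le_trans _ _ (((16 * C / a + 2) * X (a / 16)) ^+ 2)).
    by apply: lerXn2r; rewrite ?nnegrE ?addr_ge0 // mulr_ge0 ?addr_ge0 ?divr_ge0 ?mulr_ge0 // ltW.
  rewrite exprMn -C1E [X (a / 16) ^+ 2]expr2 XD.
  by have -> : a / 16 + a / 16 = a / 8 by field.
have X18 : X 8^-1 <= X 1 / (4 + 4 * C1).
  rewrite ler_pdivlMr; last by rewrite addr_gt0 // mulr_gt0.
  have -> : X 1 = X 8^-1 * X (7 / 8) by rewrite XD; congr X; field.
  by apply: ler_wpM2l => //; apply: ltW.
have Xa8 : X (a / 8) <= X 8^-1 by apply: Xle; move: a0 a2; clear; lra.
have Xa4 : X (a / 4) <= X 8^-1 by apply: Xle; move: a0 a2; clear; lra.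
have k0B : k0%:R <= (B ^ k0)%:R :> R by rewrite ler_nat ltnW // ltn_expl.
have C14 : 0 < 4 + 4 * C1 by rewrite addr_gt0 // mulr_gt0.
have k0T : k0%:R + T%:R <= X 1 / 2.
  have h1 : T%:R <= C1 * X 8^-1 by apply: (le_trans TX); apply: ler_wpM2l => //; apply: ltW.
  have h2 : (4 + 4 * C1) * X 8^-1 <= X 1 by rewrite mulrC -ler_pdivlMr.
  have h3 := X0 8^-1; have h4 : 0 <= C1 * X 8^-1 by rewrite mulr_ge0 // ltW.
  have h5 := le_trans k0B (le_trans Bk0 Xa4).
  by move: h1 h2 h3 h4 h5; rewrite mulrDl -mulrA; clear; lra.
have k0n : (k0 < n)%N.
  rewrite -(ltr_nat R) nX; have := X0 1; have : 0 <= T%:R :> R by [].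
  by move: k0T; clear; lra.
have MT : (M * T <= n - k0)%N by apply: leq_trunc_div.
have TR : 0 < T%:R :> R by rewrite ltr0n.
have M_ge : X (1 - a / 8) / (2 * C1) <= M%:R.
  have h1 : X 1 / 2 <= M%:R * T%:R.
    have := ltn_ceil (n - k0) (ltn0Sn (s0 * s0)); rewrite -/T -/M => h.
    have : ((n - k0) <= M * T + T)%N by rewrite -mulSnr ltnW.
    rewrite -(ler_nat R) natrD natrM natrB ?(ltnW k0n) // nX.
    by move: k0T; clear; lra.
  have h2 : M%:R * T%:R <= M%:R * (C1 * X (a / 8)) by apply: ler_wpM2l.
  have h3 := le_trans h1 h2.
  rewrite ler_pdivrMr ?mulr_gt0 // -(ler_pM2r (X0 (a / 8))) XD subrK.
  by move: h3; clear; lra.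
have gm0 : 0 < gm by apply: mulr_gt0.
have gmX : dl * X (- 4^-1) <= gm by apply: ler_wpM2l; [exact: ltW|apply: Xle; move: a0 a2; clear; lra].
have gm1 : gm <= 1.
  have : X (- (4^-1 - a / 2)) <= 1.
    by rewrite -[leRHS]expR0 ler_expR mulNr oppr_le0 mulr_ge0 //; move: a0 a2; clear; lra.
  by move=> h; apply: mulr_ile1 => //; apply: ltW.
have Cz : 1 <= C * z1.
  rewrite CE !mulrDl mulVf ?gt_eqF // addrAC lerDr.
  by rewrite addr_ge0 // mulr_ge0 ?invr_ge0 // ltW.
have Cth : 1 <= C * th.
  rewrite CE !mulrDl mulVf ?gt_eqF // -addrA lerDl.
  by rewrite addr_ge0 // mulr_ge0 ?invr_ge0 // ltW.
have rhos0 : rho ^+ s0 <= X (- 1).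
  rewrite /rho -expRM_natl ler_expR.
  have h1 : z1 * (C * y) <= z1 * s0%:R by apply: ler_wpM2l => //; apply: ltW.
  have h2 : 1 * y <= C * z1 * y by apply: ler_wpM2r.
  by move: h1 h2; clear; lra.
have ths0 : (1 - th) ^+ s0 <= X (- 1).
  apply: (@le_trans _ _ (expR (- th) ^+ s0)).
    apply: lerXn2r; rewrite ?nnegrE ?expR_ge0 ?subr_ge0 //.
    exact: expR_ge1Dx.
  rewrite -expRM_natl ler_expR.
  have h1 : th * (C * y) <= th * s0%:R by apply: ler_wpM2l => //; apply: ltW.
  have h2 : 1 * y <= C * th * y by apply: ler_wpM2r.
  by move: h1 h2; clear; lra.
have X34 : X (- 4^-1) = X (- 1) * X (3 / 4) by rewrite XD; congr X; field.
have Db : 0 <= 2 + 4 * D / (1 - rho) by rewrite addr_ge0 // divr_ge0 ?mulr_ge0 // ltW.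
have thdl : 0 < th * dl by apply: mulr_gt0.
have H1a : (2 + 4 * D / (1 - rho)) * 8 <= th * dl * X (3 / 4).
  rewrite -ler_pdivrMl // mulrC; apply: le_trans H1; rewrite lerDl.
  by rewrite divr_ge0 ?mulr_ge0 // ltW.
have H1b : 2 * D <= dl * X (3 / 4).
  rewrite -ler_pdivrMl // mulrC; apply: le_trans H1; rewrite lerDr.
  by rewrite divr_ge0 ?mulr_ge0 // ltW.
have C2X : (C2 + 2) * X (2^-1 + a / 4) <= cc * X (2^-1 + 7 * a / 8).
  have -> : X (2^-1 + 7 * a / 8) = X (2^-1 + a / 4) * X (5 * a / 8).
    by rewrite XD; congr X; field.
  rewrite [leRHS]mulrCA [leLHS]mulrC; apply: ler_wpM2l; first exact: ltW.
  by rewrite -ler_pdivrMl // mulrC.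
split.
- move=> k kthr; have h := le_trans kthr thr_kap.
  split; first by rewrite truncn_ge_nat.
  by rewrite -(ler_nat R); apply: le_trans s0_ge; apply: le_trans kapC.
- move=> k kthr; apply: ler_wpM2l; first exact: ltW.
  rewrite ler_expR.
  have -> : - (4^-1 - a / 2) * y = - z2 * thr by rewrite /thr; field; rewrite gt_eqF.
  by rewrite !mulNr lerN2; apply: ler_wpM2l => //; apply: ltW.
- by split.
- split.
    apply: (@le_trans _ _ ((2 + 4 * D / (1 - rho)) * X (- 1))).
      rewrite [leRHS]mulrDl; apply: lerD; apply: ler_wpM2l => //.
      by rewrite divr_ge0 ?mulr_ge0 // ltW.
    apply: (@le_trans _ _ (th * (dl * X (- 4^-1) / 8))); last first.
      by apply: ler_wpM2l; [exact: ltW|apply: ler_wpM2r].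
    rewrite X34 mulrC -(ler_pM2r (x := 8)) //.
    have := ler_wpM2l (ltW (X0 (- 1))) H1a.
    by move: (X (-1)) (X (3 / 4)) (2 + 4 * D / (1 - rho)) => x1 x2 x3; clear; lra.
  apply: (@le_trans _ _ (D * rho ^+ s0)).
    apply: ler_wpM2l; first exact: ltW.
    by apply: ler_wiXn2l; rewrite ?ltW // leq_pmull.
  apply: (@le_trans _ _ (D * X (- 1))); first by apply: ler_wpM2l => //; apply: ltW.
  rewrite ler_pdivlMr //; apply: le_trans gmX; rewrite X34.
  have := ler_wpM2l (ltW (X0 (- 1))) H1b.
  by move: (X (-1)) (X (3 / 4)) => x1 x2; clear; lra.
split => //.
have sigE : sig = X 2^-1 by [].
have half (z : R) : z <= - 1 - X 4^-1 -> expR z <= 2^-1 * expR (- X 4^-1).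
  move=> hz; apply: (@le_trans _ _ (expR (- 1) * expR (- X 4^-1))).
    by rewrite -expRD ler_expR.
  apply: ler_wpM2r; first exact: expR_ge0.
  by rewrite expRN lef_pV2 ?posrE ?expR_gt0 // expR1_ge2.
(* Here n times the rate at [k0] is O(n^(-1/2)), so the chi-square factor is at most exp (K). *)
have first_term : expR (- sig) * (1 + 16 * B%:R * (D * rho ^+ k0)) ^+ (n - k0) <=
    2^-1 * expR (- X 4^-1).
  apply: (@le_trans _ _ (expR (- X 2^-1 + K))); last first.
    apply: half; have -> : X 2^-1 = X 4^-1 * X 4^-1 by rewrite XD; congr X; field.
    have h1 : 1 <= X 4^-1 by apply: X1.
    have : X 4^-1 * (2 + K) <= X 4^-1 * X 4^-1 by apply: ler_wpM2l => //; apply: ltW.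
    have : 1 * K <= X 4^-1 * K by apply: ler_wpM2r.
    by rewrite mulrDr; move: h1; clear; lra.
  rewrite sigE expRD; apply: ler_wpM2l; first exact: expR_ge0.
  set e := D * _; have e0 : 0 <= e by rewrite mulr_ge0 ?exprn_ge0 // ltW.
  have Be : 0 <= 16 * B%:R * e by apply: mulr_ge0 => //; apply: mulr_ge0.
  apply: (le_trans (expr_le_expR _ _)); first by rewrite addr_ge0.
  rewrite ler_expR addrC addKr.
  apply: (@le_trans _ _ (16 * B%:R * (D * expR z1 * X (- (3 / 2))) * X 1)).
    apply: ler_pM => //; first by apply: ler_wpM2l; rewrite ?mulr_ge0.
    by rewrite -nX ler_nat leq_subr.
  have -> : 16 * B%:R * (D * expR z1 * X (- (3 / 2))) * X 1 = K * (X (- (3 / 2)) * X 1).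
    by rewrite KE; ring.
  rewrite XD -[leRHS]mulr1; apply: ler_wpM2l => //.
  by rewrite -[leRHS]expR0 ler_expR mulr_le0_ge0 //; clear; lra.
have second_term : (k0.+1 * n.+1 ^ (B ^ k0.+1))%:R *
     (expR ((sig + Del) / 2) * (1 - (gm / 64) ^+ 2) ^+ M) <= 2^-1 * expR (- X 4^-1).
  have p1 : k0.+1%:R <= expR (X (a / 4)).
    rewrite -natr1 addrC; apply: (le_trans (expR_ge1Dx _)).
    by rewrite ler_expR; apply: le_trans k0B Bk0.
  have p2 : (n.+1 ^ (B ^ k0.+1))%:R <= expR (2 * B%:R * X (2^-1 + a / 4)).
    rewrite natrX; apply: (@le_trans _ _ (expR (2 * X 2^-1) ^+ (B ^ k0.+1))).
      by rewrite -sqX; apply: lerXn2r; rewrite ?nnegrE ?expR_ge0 //; apply: natS_le_expR_sqrt.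
    rewrite -expRM_natl ler_expR expnS natrM -XD.
    have := ler_wpM2l (ler0n R B) (ler_wpM2r (ltW (X0 2^-1)) Bk0).
    by move: (X 2^-1) (X (a / 4)) ((B ^ k0)%:R) => x1 x2 x3; clear; lra.
  have p3 : (sig + Del) / 2 <= (1 + C0) * X (2^-1 + a / 4).
    have h1 : X 2^-1 <= X (2^-1 + a / 4) by apply: Xle; move: a0 a2; clear; lra.
    have h2 : Del <= C0 * X (2^-1 + a / 4).
      rewrite /Del sqX -XD mulrAC -mulrA; apply: ler_wpM2l => //.
      by apply: ler_wpM2l => //; apply: ltW.
    have h3 : 0 <= C0 * X (2^-1 + a / 4) by rewrite mulr_ge0 // ltW.
    by rewrite sigE [leRHS]mulrDl mul1r; move: h1 h2 h3 (X0 2^-1); clear; lra.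
  have g64 : 0 <= 1 - (gm / 64) ^+ 2.
    have aux (g : R) : 0 < g -> g <= 1 -> 0 <= g / 64 /\ g / 64 <= 1.
      by clear => g0 g1; split; lra.
    have [gg gg'] := aux _ gm0 gm1.
    by rewrite subr_ge0 exprn_ile1.
  have p4 : (1 - (gm / 64) ^+ 2) ^+ M <= expR (- (cc * X (2^-1 + 7 * a / 8))).
    apply: (le_trans (expr_le_expR _ g64)); rewrite ler_expR addrAC subrr add0r mulNr lerN2.
    apply: (@le_trans _ _ ((gm / 64) ^+ 2 * (X (1 - a / 8) / (2 * C1)))); last first.
      by apply: ler_wpM2l => //; apply: sqr_ge0.
    have -> : X (2^-1 + 7 * a / 8) =
        X (- (4^-1 - a / 2)) * X (- (4^-1 - a / 2)) * X (1 - a / 8).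
      by rewrite !XD; congr X; field.
    rewrite /gm ccE; move: (X (- (4^-1 - a / 2))) (X (1 - a / 8)) => x1 x2.
    have -> : (dl * x1 / 64) ^+ 2 * (x2 / (2 * C1)) =
        (dl / 64) ^+ 2 / (2 * C1) * (x1 * x1 * x2) by ring.
    exact: lexx.
  apply: (@le_trans _ _ (expR (X (a / 4)) * expR (2 * B%:R * X (2^-1 + a / 4)) *
     (expR ((1 + C0) * X (2^-1 + a / 4)) * expR (- (cc * X (2^-1 + 7 * a / 8)))))).
    rewrite natrM; apply: ler_pM; rewrite ?mulr_ge0 ?expR_ge0 ?exprn_ge0 //.
      exact: ler_pM.
    by apply: ler_pM; rewrite ?expR_ge0 ?exprn_ge0 // ler_expR.
  rewrite -!expRD; apply: half.
  have h1 : X (a / 4) <= X (2^-1 + a / 4) by apply: Xle; move: a0 a2; clear; lra.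
  have h2 : X 4^-1 <= X (2^-1 + a / 4) by apply: Xle; move: a0 a2; clear; lra.
  have h3 : 1 <= X (2^-1 + a / 4) by apply: X1; move: a0; clear; lra.
  move: C2X h1 h2 h3; rewrite C2E; move: (X _) (X (2^-1 + a / 4)) (X _) (X 4^-1) => x1 x2 x3 x4.
  by clear; lra.
have hh : 2^-1 + 2^-1 = 1 :> R by field.
by have := lerD first_term second_term; rewrite -mulrDl hh mul1r.
Qed.

End Asymptotics.

Theorem theorem4p7 (R : realType) (d : measure_display) (Omega : measurableType d)
  (P : probability Omega R) (A : finType) (X : int -> Omega -> A)
  (c : criterion R) (zeta1 zeta2 delta1 delta2 : R) :
  (2 <= #|A|)%N ->
  is_process X -> stationary P X -> ergodic P X ->
  weakly_non_null P X ->
  0 < zeta1 -> 0 < zeta2 -> 0 < delta1 -> 0 < delta2 -> zeta1 <= zeta2 ->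
  (forall k : nat, gamma_bar P X k <= delta1 * 2 `^ (- (zeta1 * k%:R))) ->
  (forall k : nat, delta2 * 2 `^ (- (zeta2 * k%:R)) <= gamma_low P X k) ->
  criterion_ok c ->
  exists (c2 : R) (n0 : nat) (c3 : R), 0 < c2 /\ (0 < n0)%N /\
    forall eps : R, 6 * log2 (#|A|%:R) / zeta1 <= eps -> eps < 2^-1 ->
    forall n : nat, (n0 <= n)%N ->
      (P [set w | ((khat c (sample X w n))%:R
                   <= (2 * zeta2)^-1 * (2^-1 - eps) * log2 (n%:R) - c3)%R]
       <= (expR (- (c2 * eps ^+ 3 / log2 (n%:R) * n%:R `^ (eps / 2))))%R%:E)%E.
Proof.
move=> A2 Xproc Xstat _ wnn z10 z20 d10 d20 z12 gb gl crok.
have ln20 : 0 < ln 2 :> R by rewrite ln_gt0 // ltr1n.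
pose z1 := zeta1 * ln 2; pose z2 := zeta2 * ln 2.
have z1_gt0 : 0 < z1 by apply: mulr_gt0.
have z2_gt0 : 0 < z2 by apply: mulr_gt0.
have z12' : z1 <= z2 by rewrite ler_pM2r.
have aE : 6 * log2 #|A|%:R / zeta1 = 6 * ln #|A|%:R / z1.
  by rewrite /log2 /z1; field; rewrite !gt_eqF.
(* If a >= 1/2 no [eps] is admissible and any constants do. *)
have [a2|a2] := ltP (6 * ln #|A|%:R / z1) 2^-1; last first.
  exists 1, 1%N, 0; split => //; split => // eps; rewrite aE => h1 h2.
  by have := lt_le_trans (le_lt_trans h1 h2) a2; rewrite ltxx.
(* Capping delta2 at 1 keeps [gm] at most 1, as the affinity bound requires. *)
pose rho := expR (- z1); pose dl := Num.min delta2 1.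
have dl0 : 0 < dl by rewrite lt_min d20 ltr01.
have dl1 : dl <= 1 by rewrite ge_min lexx orbT.
have rho0 : 0 < rho by apply: expR_gt0.
have rho1 : rho < 1 by rewrite -[ltRHS]expR0 ltr_expR oppr_lt0.
have pow2 z (k : nat) : 2 `^ (- (z * k%:R)) = expR (- (z * ln 2) * k%:R) :> R.
  by rewrite /powR pnatr_eq0 /=; congr expR; ring.
have gb' k : gamma_bar P X k <= delta1 * rho ^+ k.
  by have := gb k; rewrite pow2 [X in expR X]mulrC expRM_natl.
pose g (k : nat) : R := dl * expR (- z2 * k%:R).
have gl' k : g k <= gamma_low P X k.
  apply: le_trans (gl k); rewrite pow2; apply: ler_wpM2r; first exact: expR_ge0.
  by rewrite ge_min lexx.
have /card_gt0P[a0 _] : (0 < #|A|)%N by apply: leq_trans A2.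
pose p := law P X; have plaw : stationary_law p := law_stationary Xproc Xstat.
have cont := law_cont Xproc Xstat a0 d10 rho0 rho1 gb'.
have gap := law_gap Xproc Xstat a0 gb' gl'.
have alc := law_cond_ge Xproc Xstat a0 d10 rho0 rho1 gb'.
have [th th01 hth] := overlap_uniform plaw d10 rho0 rho1 cont alc wnn.
have [C0 [N0 [C00 hIC]]] := @IC_le_ML R A A2 c crok.
have dl01 : 0 < dl <= 1 by rewrite dl0.
have [N1 hN1] := asymptotic_parameters A2 C00 d10 z1_gt0 z12' dl01 th01 a2.
(* The event for eps is contained in the one for the smallest admissible value
   a = 6 log |A| / zeta1, whose probability is at most exp(- n^(1/4)); this is
   below the required bound because eps < 1/2. *)
exists 1, (maxn 2 (maxn N0 N1)), 0; split => //; split; first by rewrite leq_max.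
move=> eps; rewrite aE => aeps eps2 n; rewrite !geq_max => /andP[n2 /andP[nN0 nN1]].
have n0 : (0 < n)%N by apply: ltnW.
have y0 : 0 <= ln n%:R :> R by rewrite ln_ge0 // ler1n.
have [k0 [J [s0 [M [gm [thrk hgm [J0 [gm0 gm1]] [h1 h2] [e1 k0n MT fin]]]]]]] := hN1 n nN1.
set thr := _ / (2 * z2) * ln n%:R in thrk hgm.
have eps0 : 0 < eps.
  by apply: lt_le_trans aeps; rewrite divr_gt0 // mulr_gt0 // ln_gt0 // ltr1n.
have thr_eps : (2 * zeta2)^-1 * (2^-1 - eps) * log2 n%:R - 0 <= thr.
  rewrite subr0 /thr /log2 /z2.
  have -> : (2 * zeta2)^-1 * (2^-1 - eps) * (ln n%:R / ln 2) =
     (2^-1 - eps) / (2 * (zeta2 * ln 2)) * ln n%:R by field; rewrite !gt_eqF.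
  apply: ler_wpM2r => //; apply: ler_wpM2r.
    by rewrite invr_ge0 !mulr_ge0 // ltW.
  by rewrite lerD2l lerN2.
rewrite (probability_sample Xproc Xstat n (fun s => (khat c s)%:R <=
   (2 * zeta2)^-1 * (2^-1 - eps) * log2 n%:R - 0)) lee_fin.
apply: (@le_trans _ _ (\sum_(s : n.-tuple A | (khat c s)%:R <= thr) p s)).
  rewrite big_mkcond [leRHS]big_mkcond; apply: ler_sum => s _.
  have ps0 : 0 <= p s by case: plaw.
  by case: ifPn => [h|_]; [rewrite (le_trans h thr_eps)|case: ifP].
apply: le_trans (khat_small_prob (cr := c) A2 plaw d10 rho0 rho1 cont (Num.sqrt n%:R) thrk _ th01
  (hth s0) J0 gm0 gm1 h1 h2 e1 k0n MT _) _.
- move=> k x w kthr sw px; apply: le_trans (gap x w px).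
  by rewrite lerD2r sw; apply: hgm.
- move=> k s kk0 hk; have := hIC k k0 s; rewrite size_tuple; exact.
apply: (le_trans fin); rewrite ler_expR lerN2.
(* As n >= 2, the prefactor eps^3 / log n is at most 1; and eps / 2 < 1/4. *)
have log2_ge1 : 1 <= log2 n%:R :> R.
  by rewrite /log2 ler_pdivlMr // mul1r ler_ln ?posrE ?ltr0n // ler_nat.
have -> : n%:R `^ (eps / 2) = expR (eps / 2 * ln n%:R) :> R.
  by rewrite /powR pnatr_eq0 gtn_eqF.
rewrite -[leRHS]mul1r; apply: ler_pM; rewrite ?expR_ge0 //.
- by rewrite !mulr_ge0 ?invr_ge0 ?exprn_ge0 // ?(ltW eps0) ?(le_trans _ log2_ge1).
- rewrite mul1r ler_pdivrMr ?(lt_le_trans _ log2_ge1) // mul1r.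
  apply: le_trans log2_ge1; apply: exprn_ile1; first exact: ltW.
  by move: eps2; lra.
rewrite ler_expR; apply: ler_wpM2r => //; move: eps2; lra.
Qed.
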